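(* Let $p$ be a prime, $n\ge 1$, and let $f_1,\dots,f_n$ be independent random homogeneous polynomials in $\mathbb{Z}_p[x_0,\dots,x_n]$ of degrees $d_1,\dots,d_n\ge 1$, each sampled from the uniform distribution. Then $$\mathbb{E}\,\# Z(f_1,\dots,f_n)=1.$$
   Context: $\mathbb{Z}_p$ carries the Haar probability measure; a $\mathbb{Z}_p$-valued random variable is uniform if its law is this measure. The uniform distribution on homogeneous polynomials of degree $d$ in $x_0,\dots,x_n$ with coefficients in $\mathbb{Z}_p$ is the law of $f=\sum_{|\alpha|=d}\xi_\alpha x_0^{\alpha_0}\cdots x_n^{\alpha_n}$ with $\{\xi_\alpha\}_{|\alpha|=d}$ i.i.d. uniform in $\mathbb{Z}_p$. $Z(f_1,\dots,f_n)\subset\mathbb{Q}_p\mathrm{P}^n$ is the common zero set in the projective space over $\mathbb{Q}_p$ (the set of lines through $0$ in $\mathbb{Q}_p^{n+1}$). *)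

(* Defs.v *)
From HB Require Import structures.
From mathcomp Require Import all_boot all_order all_algebra.
From mathcomp Require Import all_classical all_reals all_analysis.
(* The notations of mpoly.v clash with those of MathComp-Analysis. *)
From mathcomp Require Import -(notations) mpoly.

Set Implicit Arguments.
Unset Strict Implicit.
Unset Printing Implicit Defensive.

Import GRing.Theory.

Local Open Scope classical_set_scope.
Local Open Scope ring_scope.

(* Inverse limit of the rings Z/p^k: [x k] is the canonical representative, in
   [0, p^k), of the class of x modulo p^k; the bound is implied by the
   compatibility equation. *)
Definition compatible_residues (p : nat) (x : nat -> nat) : Prop :=
  forall k, x k = (x k.+1 %% p ^ k)%N.

Record padic_int (p : nat) (p_pr : prime p) : Type := PadicInt {
  residue :> nat -> nat;
  _ : `[< compatible_residues p residue >] }.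

HB.instance Definition _ p (p_pr : prime p) := [isSub for @residue p p_pr].
HB.instance Definition _ p (p_pr : prime p) := [Choice of padic_int p_pr by <:].

Section PadicRing.
Variables (p : nat) (p_pr : prime p).
Local Notation Zp := (padic_int p_pr).
Implicit Types x y z : Zp.

Lemma residue_compat x k : x k = (x k.+1 %% p ^ k)%N.
Proof. by case: x => x hx; exact: (asboolW hx). Qed.

Lemma residue_mod x k : (x k %% p ^ k)%N = x k.
Proof. by rewrite residue_compat modn_mod. Qed.

Lemma residue_le x i j : (i <= j)%N -> x i = (x j %% p ^ i)%N.
Proof.
elim: j => [|j IH]; first by rewrite leqn0 => /eqP ->; rewrite residue_mod.
rewrite leq_eqVlt => /orP[/eqP ->|]; first by rewrite residue_mod.
rewrite ltnS => ij; rewrite (IH ij) (residue_compat x j) modn_dvdm//.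
exact: dvdn_exp2l.
Qed.

Lemma padicP x y : (forall k, x k = y k) -> x = y.
Proof. by move=> xy; apply: val_inj; apply/funext. Qed.

Definition padic_of (f : nat -> nat)
    (hf : forall k, f k.+1 = f k %[mod p ^ k]) : Zp.
Proof.
refine (@PadicInt p p_pr (fun k => f k %% p ^ k)%N _).
apply/asboolP => k; rewrite modn_dvdm ?hf//.
exact: dvdn_exp2l.
Defined.

Lemma padic0_sub k : 0 = 0 %[mod p ^ k]. Proof. by []. Qed.
Lemma padic1_sub k : 1 = 1 %[mod p ^ k]. Proof. by []. Qed.
Lemma padicD_sub x y k : (x k.+1 + y k.+1 = x k + y k %[mod p ^ k])%N.
Proof. by rewrite (residue_compat x k) (residue_compat y k) modnDm. Qed.
Lemma padicM_sub x y k : (x k.+1 * y k.+1 = x k * y k %[mod p ^ k])%N.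
Proof. by rewrite (residue_compat x k) (residue_compat y k) modnMm. Qed.
Lemma padicN_sub x k :
  (p ^ k.+1 - x k.+1 = p ^ k - x k %[mod p ^ k])%N.
Proof.
have lex j : (x j <= p ^ j)%N.
  by rewrite -residue_mod ltnW// ltn_pmod// expn_gt0 prime_gt0.
apply/eqP; rewrite -(eqn_modDr (x k.+1)) subnK//.
rewrite -(modnDmr _ (x k.+1)) -residue_compat subnK//.
by rewrite expnS modnMl modnn.
Qed.

Definition padic0 : Zp := padic_of padic0_sub.
Definition padic1 : Zp := padic_of padic1_sub.
Definition padic_add x y : Zp := padic_of (padicD_sub x y).
Definition padic_mul x y : Zp := padic_of (padicM_sub x y).
Definition padic_opp x : Zp := padic_of (padicN_sub x).

Lemma padic_addA : associative padic_add.
Proof. by move=> x y z; apply: padicP => k /=; rewrite modnDmr modnDml addnA. Qed.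
Lemma padic_addC : commutative padic_add.
Proof. by move=> x y; apply: padicP => k /=; rewrite addnC. Qed.
Lemma padic_add0 : left_id padic0 padic_add.
Proof. by move=> x; apply: padicP => k /=; rewrite mod0n residue_mod. Qed.
Lemma padic_addN : left_inverse padic0 padic_opp padic_add.
Proof.
move=> x; apply: padicP => k /=; rewrite modnDml subnK ?modnn ?mod0n//.
by rewrite -residue_mod ltnW// ltn_pmod// expn_gt0 prime_gt0.
Qed.

HB.instance Definition _ := GRing.isZmodule.Build Zp
  padic_addA padic_addC padic_add0 padic_addN.

Lemma padic_mulA : associative padic_mul.
Proof. by move=> x y z; apply: padicP => k /=; rewrite modnMmr modnMml mulnA. Qed.
Lemma padic_mulC : commutative padic_mul.
Proof. by move=> x y; apply: padicP => k /=; rewrite mulnC. Qed.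
Lemma padic_mul1 : left_id padic1 padic_mul.
Proof. by move=> x; apply: padicP => k /=; rewrite modnMml mul1n residue_mod. Qed.
Lemma padic_mulDl : left_distributive padic_mul padic_add.
Proof.
by move=> x y z; apply: padicP => k /=; rewrite modnMml modnDm mulnDl.
Qed.
Lemma padic_one_neq0 : padic1 != padic0.
Proof.
apply/eqP => /(congr1 (fun x : Zp => x 1%N)) /=.
by rewrite expn1 mod0n modn_small// prime_gt1.
Qed.

HB.instance Definition _ :=
  GRing.Zmodule_isComNzRing.Build Zp padic_mulA padic_mulC padic_mul1
    padic_mulDl padic_one_neq0.

Definition padic_unit : pred Zp := fun x => `[< exists y, y * x = 1 >].
Definition padic_inv x : Zp :=
  if pselect (exists y, y * x = 1) is left h then projT1 (cid h) else x.

Lemma padic_mulV : {in padic_unit, left_inverse 1 padic_inv *%R}.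
Proof.
move=> x /asboolP hx; rewrite /padic_inv; case: pselect => // h.
exact: (projT2 (cid h)).
Qed.
Lemma padic_unitP x y : y * x = 1 -> padic_unit x.
Proof. by move=> yx; apply/asboolP; exists y. Qed.
Lemma padic_inv_out : {in [predC padic_unit], padic_inv =1 id}.
Proof. by move=> x /asboolP hx; rewrite /padic_inv; case: pselect. Qed.

HB.instance Definition _ :=
  GRing.ComNzRing_hasMulInverse.Build Zp padic_mulV padic_unitP padic_inv_out.

Lemma padic_neq0_residue x : x != 0 -> exists k, x k != 0%N.
Proof.
move=> x0; apply/not_existsP => h; move/eqP: x0; apply.
apply: padicP => k; have /negP/negPn/eqP -> := h k.
by rewrite /= mod0n.
Qed.

Lemma padic_mulf_eq0 x y : x * y = 0 -> (x == 0) || (y == 0).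
Proof.
move=> xy0; apply/negPn/negP; rewrite negb_or => /andP[].
move=> /padic_neq0_residue[i xi] /padic_neq0_residue[j yj].
have ndiv (z : Zp) a : z a != 0%N -> (a <= i + j)%N ->
    (0 < z (i + j))%N /\ (logn p (z (i + j)%N) < a)%N.
  move=> za aij; have nd : ~~ (p ^ a %| z (i + j))%N.
    by rewrite /dvdn -residue_le.
  have z0 : (0 < z (i + j))%N by case: (z _) nd => //; rewrite dvdn0.
  by split=> //; rewrite ltnNge -pfactor_dvdn.
have [x0 lx] := ndiv x i xi (leq_addr _ _).
have [y0 ly] := ndiv y j yj (leq_addl _ _).
have : (p ^ (i + j) %| x (i + j) * y (i + j))%N.
  move: (congr1 (fun z : Zp => z (i + j)%N) xy0) => /= h.
  by rewrite /dvdn h mod0n.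
rewrite pfactor_dvdn ?muln_gt0 ?x0// lognM//.
by rewrite leqNgt -addnS leq_add// ltnW.
Qed.

HB.instance Definition _ :=
  GRing.ComUnitRing_isIntegral.Build Zp padic_mulf_eq0.

(* The p-adic topology: the sets [set y | y k = x k] = x + p^k Z_p form a basis
   of neighbourhoods of x. *)
Definition padic_open : set_system Zp :=
  [set U | forall x, U x -> exists k : nat, forall y, y k = x k -> U y].

Lemma padic_openT : padic_open [set: Zp].
Proof. by move=> x _; exists 0%N. Qed.
Lemma padic_openI : setI_closed padic_open.
Proof.
move=> A B oA oB x [/oA[i Ai] /oB[j Bj]]; exists (maxn i j) => y yx.
split; [apply: Ai|apply: Bj].
  by rewrite !(residue_le _ (leq_maxl i j)) yx.
by rewrite !(residue_le _ (leq_maxr i j)) yx.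
Qed.
Lemma padic_open_bigU (I : Type) (f : I -> set Zp) :
  (forall i, padic_open (f i)) -> padic_open (\bigcup_i f i).
Proof.
by move=> of_ x [i _ /of_[k fk]]; exists k => y /fk ?; exists i.
Qed.

HB.instance Definition _ := isPointed.Build Zp 0.
HB.instance Definition _ := isOpenTopological.Build Zp
  padic_openT padic_openI padic_open_bigU.

Definition padic_borel := g_sigma_algebraType (@open Zp).
HB.instance Definition _ := Measurable.copy Zp padic_borel.

End PadicRing.

Section Random.
Context (R : realType) (disp : measure_display) (T : measurableType disp).
Variable P : probability T R.

(* Mutual independence of the families of events F i, for i in D. *)
Definition mutually_independent (I : choiceType) (D : set I)
    (F : I -> set (set T)) : Prop :=
  forall (J : seq I), uniq J -> [set` J] `<=` D ->
  forall E : I -> set T, (forall i, i \in J -> F i (E i)) ->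
  P (\bigcap_(i in [set` J]) E i) = (\prod_(i <- J) P (E i))%E.

Variables (p : nat) (p_pr : prime p).
Local Notation Zp := (padic_int p_pr).

Definition translation_invariant (mu : set Zp -> \bar R) : Prop :=
  forall (a : Zp) (A : set Zp), measurable A ->
  mu [set a + x | x in A] = mu A.

(* The law of X is a Borel probability measure on Z_p, so that it is the Haar
   probability measure exactly when it is translation invariant. *)
Definition uniform_padic (X : T -> Zp) : Prop :=
  measurable_fun [set: T] X /\ translation_invariant (pushforward P X).

Definition rv_events (X : T -> Zp) : set (set T) :=
  preimage_set_system [set: T] X measurable.

Variable n : nat.

Definition hpoly_events (d : nat) (f : T -> dhomog n Zp d) : set (set T) :=
  <<s \bigcup_(m in [set: multinom n])
        rv_events (fun w => mcoeff m (f w)) >>.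

Definition uniform_hpoly (d : nat) (f : T -> dhomog n Zp d) : Prop :=
  (forall m : multinom n, mdeg m = d ->
     uniform_padic (fun w => mcoeff m (f w))) /\
  mutually_independent [set m : multinom n | mdeg m = d]
    (fun m => rv_events (fun w => mcoeff m (f w))).

End Random.

Definition projective_space (K : fieldType) (n : nat) :=
  {L : {vspace 'rV[K]_n.+1} | \dim L == 1%N}.

HB.instance Definition _ (K : fieldType) (n : nat) :=
  Choice.on (projective_space K n).

(* Common zeros, over the fraction field, of polynomials with coefficients in
   an integral domain A. *)
Definition proj_zeros (A : idomainType) (n : nat) (I : Type)
    (f : I -> mpoly n.+1 A) : set (projective_space {fraction A} n) :=
  [set L : projective_space {fraction A} n |
           forall i (v : 'rV_n.+1), v \in sval L ->
           meval (fun j => v 0 j) (map_mpoly (@tofrac A) (f i)) = 0].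

(* Main.v *)
Require Import Defs.
From HB Require Import structures.
From mathcomp Require Import all_boot all_order all_algebra.
From mathcomp Require Import all_classical all_reals all_analysis measurable_realfun.
From mathcomp Require Import cyclic ring.
From mathcomp Require Import -(notations) mpoly.

(* Every line in Q_p^(n+1) has a unique representative x in Z_p^(n+1) whose
   first unit coordinate, the pivot j, equals 1. Cut the set of these vectors
   into balls modulo P = p^k; the number of balls containing a zero increases
   to #Z, so its expectation, the sum over the balls of the probability of
   containing a zero, converges to E #Z.
   Around a centre b with pivot j, f(b + P h) = a + P L h + P^2 Q(h) with
   h_j = 0. The matrix M formed by a = f(b), as column j, and L is the image of
   the coefficients of f under a surjective morphism, hence is uniform modulo
   P^2. If P does not divide det L, then by a Newton iteration the ball contains
   a zero of f iff M has a kernel vector e_j + P h modulo P^2, and the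
   probability of this is that of a uniform M having a kernel vector in the ball
   of b. A matrix with a maximal minor nonzero modulo P has its kernel, spanned
   by the maximal minors, in exactly one ball, so these probabilities sum to
   that of M having such a minor. It remains to bound the probability q that P
   divides a given minor det L: L and the L + t Id are equidistributed, and
   t |-> det (L + t Id), being monic of degree n, vanishes modulo P for at most n
   of the t < N when k is large, whence q <= n / N. *)

Set Implicit Arguments.
Unset Strict Implicit.
Unset Printing Implicit Defensive.

Import Order.TTheory GRing.Theory Num.Theory.

Local Open Scope ring_scope.

(** * p-adic integers: divisibility and compactness *)

Section PadicIntegers.
Local Open Scope classical_set_scope.
Variables (p : nat) (p_pr : prime p).
Local Notation Zp := (padic_int p_pr).
Implicit Types x y z : Zp.

Lemma residueD x y k : (x + y) k = ((x k + y k) %% p ^ k)%N.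
Proof. by []. Qed.

Lemma residueM x y k : (x * y) k = ((x k * y k) %% p ^ k)%N.
Proof. by []. Qed.

Lemma residue0 k : (0 : Zp) k = 0%N.
Proof. exact: mod0n. Qed.

Lemma residue1 k : (1 : Zp) k = (1 %% p ^ k)%N.
Proof. by []. Qed.

Lemma residue_nat m k : (m%:R : Zp) k = (m %% p ^ k)%N.
Proof.
elim: m => [|m IH]; first by rewrite residue0 mod0n.
by rewrite -addn1 natrD residueD IH residue1 modnDm.
Qed.

Lemma residue_at0 x : x 0%N = 0%N.
Proof. by rewrite -residue_mod expn0 modn1. Qed.

Lemma padic_natr_eq0 m : (m%:R == 0 :> Zp) = (m == 0%N).
Proof.
apply/eqP/eqP => [m0|-> //]; move: (congr1 (fun z : Zp => z m) m0).
rewrite residue_nat [RHS]residue0 modn_small//.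
exact: ltn_expl (prime_gt1 p_pr).
Qed.

Lemma residueB0 x y k : ((x - y) k = 0%N) <-> x k = y k.
Proof.
split=> [xy|xy].
  by rewrite -[x in LHS](subrK y) residueD xy add0n residue_mod.
by rewrite residueD xy -residueD subrr residue0.
Qed.

Lemma residue_add0 x y k : y k = 0%N -> (x + y) k = x k.
Proof. by move=> y0; rewrite residueD y0 addn0 residue_mod. Qed.

Lemma residue_mul0 x y k : y k = 0%N -> (x * y) k = 0%N.
Proof. by move=> y0; rewrite residueM y0 muln0 mod0n. Qed.

Lemma residue_sum0 (I : Type) (r : seq I) (Q : pred I) (F : I -> Zp) k :
  (forall i, Q i -> F i k = 0%N) -> (\sum_(i <- r | Q i) F i) k = 0%N.
Proof.
move=> F0; elim/big_rec: _ => [|i x Qi x0]; first exact: residue0.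
by rewrite residue_add0// F0.
Qed.

Lemma residue_weaken x y i j : (i <= j)%N -> x j = y j -> x i = y i.
Proof. by move=> ij xy; rewrite !(residue_le _ ij) xy. Qed.

Lemma residue_weaken0 x i j : (i <= j)%N -> x j = 0%N -> x i = 0%N.
Proof. by move=> ij x0; rewrite (residue_le _ ij) x0 mod0n. Qed.

Lemma padic_eq0P x : (forall k, x k = 0%N) -> x = 0.
Proof. by move=> x0; apply: padicP => k; rewrite residue0. Qed.

Lemma residue_pexp k j : (k >= j)%N -> (p%:R ^+ k : Zp) j = 0%N.
Proof.
by move=> jk; rewrite -natrX residue_nat; apply/eqP; exact: dvdn_exp2l.
Qed.

(** The quotient is a shift of digits: its residue modulo p^j is [x (j + k)] divided by p^k. *)
Lemma residue_dvdP x k : x k = 0%N <-> exists y, x = p%:R ^+ k * y.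
Proof.
split=> [x0|[y ->]]; last by rewrite mulrC residue_mul0// residue_pexp.
have pk0 i : (0 < p ^ i)%N by rewrite expn_gt0 prime_gt0.
have hf j : (x (j.+1 + k) %/ p ^ k = x (j + k) %/ p ^ k %[mod p ^ j])%N.
  rewrite addSn (residue_compat x (j + k)) expnD.
  by rewrite -modn_divl modn_mod.
exists (padic_of p_pr hf); apply: padicP => j.
rewrite -natrX residueM residue_nat /= modnMm mulnC divnK; last first.
  by rewrite /dvdn -residue_le ?leq_addl// x0.
by rewrite -residue_le// leq_addr.
Qed.

(** By Euler's theorem x^(phi(p^k) - 1) inverts x modulo p^k. These inverses form a compatible
    sequence because an inverse modulo p^k is unique. *)
Lemma padic_unit_residue x : x 1%N != 0%N -> x \is a GRing.unit.
Proof.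
move=> x1.
have pk0 i : (0 < p ^ i)%N by rewrite expn_gt0 prime_gt0.
have cop k : coprime (x k) (p ^ k).
  case: k => [|k]; first by rewrite expn0 coprimen1.
  rewrite coprimeXr// coprime_sym prime_coprime// /dvdn.
  by have := residue_le x (ltn0Sn k); rewrite expn1 => <-.
pose y k := (x k ^ (totient (p ^ k)).-1)%N.
have xy k : (x k * y k = 1 %[mod p ^ k])%N.
  by rewrite /y -expnS prednK ?totient_gt0// Euler_exp_totient.
have hy k : (y k.+1 = y k %[mod p ^ k])%N.
  have xy' : (x k * y k.+1 = 1 %[mod p ^ k])%N.
    rewrite (residue_compat x k) modnMml -(@modn_dvdm (p ^ k.+1)) ?dvdn_exp2l//.
    by rewrite xy modn_dvdm ?dvdn_exp2l.
  rewrite -[in LHS](muln1 (y k.+1)) -modnMmr -(xy k) modnMmr mulnCA mulnA.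
  by rewrite -modnMml xy' modnMml mul1n.
apply/unitrP; exists (padic_of p_pr hy).
suff yx : padic_of p_pr hy * x = 1 by rewrite [x * _]mulrC.
by apply: padicP => k; rewrite residueM /= modnMml mulnC xy.
Qed.

Lemma padic_valuation x : x != 0 ->
  exists v u, [/\ x = p%:R ^+ v * u, u \is a GRing.unit & x v.+1 != 0%N].
Proof.
move=> /padic_neq0_residue ex; case: (ex_minnP ex) => -[|v] xv vmin.
  by rewrite residue_at0 in xv.
have /residue_dvdP[u xu] : x v = 0%N.
  by apply/eqP/negPn/negP => /vmin; rewrite ltnn.
exists v, u; split=> //; apply: padic_unit_residue; apply: contra_neq xv.
move=> /residue_dvdP[z uz].
by apply/residue_dvdP; exists z; rewrite {1}xu uz mulrA -exprD addn1.
Qed.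

Lemma padic_p_neq0 : p%:R != 0 :> Zp.
Proof. by rewrite padic_natr_eq0 -lt0n prime_gt0. Qed.

Lemma padic_pexp_neq0 k : p%:R ^+ k != 0 :> Zp.
Proof. exact/expf_neq0/padic_p_neq0. Qed.

(** The valuation of x is less than k, so p^k / x still contains a factor p. This spare factor makes
    the Newton map of [solvable_zero_in_ball] contract. *)
Lemma residue_ndvd x k : x k != 0%N -> exists y, p%:R ^+ k = x * (p%:R * y).
Proof.
move=> xk; have x0 : x != 0 by apply: contra_neq xk => ->; rewrite residue0.
have [v [u [xu uU xv]]] := padic_valuation x0.
have vk : (v < k)%N.
  rewrite ltnNge; apply/negP => kv; move/eqP: xk; apply.
  by apply: (residue_weaken0 kv); rewrite xu mulrC residue_mul0// residue_pexp.
exists (p%:R ^+ (k - v.+1) * u^-1).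
rewrite {1}xu; transitivity (p%:R ^+ v * p%:R * p%:R ^+ (k - v.+1) * (u / u)).
  by rewrite divrr// mulr1 -exprSr -exprD subnKC.
by ring.
Qed.

(** Z_p is a valuation ring: the element of smaller valuation divides the other. *)
Lemma padic_dvd_total x y : (exists c, y = c * x) \/ (exists c, x = c * y).
Proof.
have [->|x0] := eqVneq x 0; first by right; exists 0; rewrite mul0r.
have [->|y0] := eqVneq y 0; first by left; exists 0; rewrite mul0r.
have [v [u [-> uU _]]] := padic_valuation x0.
have [v' [u' [-> uU' _]]] := padic_valuation y0.
have [vv|vv] := leqP v v'; [left|right].
  exists (p%:R ^+ (v' - v) * u' * u^-1).
  transitivity (p%:R ^+ (v' - v) * p%:R ^+ v * u' * (u / u)); last by ring.
  by rewrite divrr// mulr1 -exprD subnK.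
exists (p%:R ^+ (v - v') * u * u'^-1).
transitivity (p%:R ^+ (v - v') * p%:R ^+ v' * u * (u' / u')); last by ring.
by rewrite divrr// mulr1 -exprD subnK// ltnW.
Qed.

(** Writing p^k = x p e, one gets p^k y = p e (x y), which is divisible by p^(2k); then p^k
    cancels. *)
Lemma residue_mul_cancel x y k :
  x k != 0%N -> (x * y) (k + k)%N = 0%N -> y k = 0%N.
Proof.
move=> /residue_ndvd[e pe] /residue_dvdP[z xyz]; apply/residue_dvdP.
exists (p%:R * e * z); apply: (mulfI (padic_pexp_neq0 k)).
rewrite {1}pe; transitivity (p%:R * e * (x * y)); first by ring.
by rewrite xyz exprD; ring.
Qed.

(* Reduction modulo p^(k+1), not p^k: 'Z_(p ^ 0) would be Z/2. *)
Definition red k x : 'Z_(p ^ k.+1) := inZp (x k.+1).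

Lemma red_modulus k : ((Zp_trunc (p ^ k.+1)).+2 = p ^ k.+1)%N.
Proof.
apply: Zp_cast; apply: leq_trans (prime_gt1 p_pr) _.
by rewrite -[in leqLHS](expn1 p) leq_exp2l// prime_gt1.
Qed.

Lemma redE k x : red k x = x k.+1 :> nat.
Proof. by rewrite /= red_modulus residue_mod. Qed.

Lemma red_eq k x y : red k x = red k y <-> x k.+1 = y k.+1.
Proof.
split=> [xy|xy]; first by rewrite -redE xy redE.
by apply: ord_inj; rewrite !redE.
Qed.

Lemma red_is_zmod_morphism k : zmod_morphism (red k).
Proof.
move=> x y; apply/(addIr (red k y)); rewrite subrK; apply: ord_inj.
apply: esym; rewrite redE; change (residue x k.+1 =
  modn (addn (red k (x - y)) (red k y)) (Zp_trunc (p ^ k.+1)%N).+2).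
by rewrite !redE red_modulus -residueD subrK.
Qed.

Lemma red_is_monoid_morphism k : monoid_morphism (red k).
Proof.
split=> [|x y]; apply: ord_inj; rewrite redE.
  by rewrite residue1 -[in LHS](red_modulus k).
change (residue (x * y) k.+1 =
  modn (muln (red k x) (red k y)) (Zp_trunc (p ^ k.+1)%N).+2).
by rewrite !redE red_modulus.
Qed.

HB.instance Definition _ k :=
  GRing.isZmodMorphism.Build Zp 'Z_(p ^ k.+1) (red k) (red_is_zmod_morphism k).
HB.instance Definition _ k :=
  GRing.isMonoidMorphism.Build Zp 'Z_(p ^ k.+1) (red k)
    (red_is_monoid_morphism k).

Lemma red_eq0 k x : red k x = 0 <-> x k.+1 = 0%N.
Proof. by rewrite -(rmorph0 (red k)) red_eq residue0. Qed.

Definition lift_red k (r : 'Z_(p ^ k.+1)) : Zp := (r : nat)%:R.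

Lemma lift_redK k : cancel (@lift_red k) (red k).
Proof.
move=> r; apply: ord_inj; rewrite redE residue_nat.
by rewrite modn_small// -[ltnRHS]red_modulus.
Qed.

(* An ultrafilter limit: on each finite level the residues take finitely many
   values, so one of them is selected by the ultrafilter. *)
Lemma padic_cluster (I : finType) (u : nat -> I -> Zp) :
  exists x : I -> Zp, forall k M, exists2 m, (M <= m)%N & forall i, u m i k = x i k.
Proof.
have [U [UU sU]] := ultraFilterLemma eventually_filter.
have PU : ProperFilter U := @ultra_proper _ _ UU.
have sel i k : exists r : nat, U [set m | u m i k = r].
  apply/not_existsP => nor.
  have : U (\bigcap_(r in `I_(p ^ k)) ~` [set m | u m i k = r]).
    elim: (p ^ k)%N => [|b IH].
      by apply: (filterS _ filterT) => m _ r.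
    have [/nor//|Ub] := in_ultra_setVsetC [set m | u m i k = b] UU.
    apply: filterS (filterI Ub IH) => m [/= mb mr] r /=.
    by rewrite ltnS leq_eqVlt => /orP[/eqP -> //|rb]; exact: mr.
  move=> /filter_ex[m] /(_ (u m i k)); apply=> //=.
  by rewrite -residue_mod ltn_mod expn_gt0 prime_gt0.
pose r i k := projT1 (cid (sel i k)).
have rP i k : U [set m | u m i k = r i k] := projT2 (cid (sel i k)).
have hr i k : (r i k.+1 = r i k %[mod p ^ k])%N.
  have [m [/= <- <-]] := filter_ex (filterI (rP i k.+1) (rP i k)).
  by rewrite -residue_compat residue_mod.
exists (fun i => padic_of p_pr (hr i)) => k M.
have UM : U [set m | (M <= m)%N] by apply: sU; exists M.
have Ur : U [set m | forall i, u m i k = r i k].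
  exact: (@filter_forall _ _ (fun i => [set m | u m i k = r i k]) U _ (rP^~ k)).
have [m [/= Mm mr]] := filter_ex (filterI UM Ur).
by exists m => // i; rewrite /= -mr residue_mod.
Qed.

End PadicIntegers.

(** * Determinants *)

Section CharPoly.

(** This exhibits the determinant of a scalar translate of A as the value at a of a monic polynomial
    of degree n. *)
Lemma horner_char_polyN (R : comNzRingType) n (A : 'M[R]_n) (a : R) :
  (char_poly (- A)).[a] = \det (A + a%:M).
Proof.
rewrite /char_poly -[LHS]/(horner_eval a _) -det_map_mx; congr (\det _).
apply/matrixP => i j; rewrite !mxE /horner_eval.
by rewrite /= /horner_eval hornerD hornerN hornerMn hornerX hornerC opprK addrC.
Qed.

(** Entry i of the product is the expansion, along the first row, of the determinant of A with a
    copy of its row i put on top. *)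
Lemma mulmx_minors (R : comNzRingType) n (A : 'M[R]_(n, n.+1)) :
  A *m (\col_s ((-1) ^+ s * \det (col' s A))) = 0.
Proof.
apply/matrixP => i z; rewrite !mxE.
pose C : 'M[R]_(1 + n) := col_mx (row i A) A.
have C0 s : C ord0 s = A i s.
  by rewrite -[ord0](_ : lshift n (0 : 'I_1) = _) ?col_mxEu ?mxE//; exact: ord_inj.
have Cl l s : C (lift ord0 l) s = A l s.
  by rewrite -[lift _ _](_ : rshift 1 l = _) ?col_mxEd//; exact: ord_inj.
have C00 : \det C = 0.
  apply: (@determinant_alternate _ _ _ ord0 (lift ord0 i)) => // s.
  by rewrite C0 Cl.
rewrite -[RHS]C00 (expand_det_row _ ord0); apply: eq_bigr => s _.
rewrite C0 mxE /cofactor add0n; congr (_ * (_ * \det _)).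
by apply/matrixP => l m; rewrite [LHS]mxE [RHS]mxE [RHS]mxE Cl.
Qed.

End CharPoly.

Section PadicVectors.
Variables (p : nat) (p_pr : prime p).
Local Notation Zp := (padic_int p_pr).

Section Roots.
Variable n : nat.

(** Distinct natural numbers stay distinct in Z_p, so each determinant is nonzero. There are
    finitely many t, hence a common power of p divides none of the determinants. *)
Lemma vandermonde_padic (N : nat) :
  exists m0, forall m, (m0 <= m)%N -> forall t : 'I_n.+1 -> 'I_N, injective t ->
    \det (Vandermonde n.+1 (\row_i ((t i)%:R : Zp))) m != 0%N.
Proof.
pose V (t : {ffun 'I_n.+1 -> 'I_N}) :=
  \det (Vandermonde n.+1 (\row_i ((t i)%:R : Zp))).
have Vex (t : {ffun 'I_n.+1 -> 'I_N}) : exists m, injective t -> V t m != 0%N.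
  have [ti|ti] := pselect (injective t); last by exists 0%N.
  have : V t != 0.
    rewrite /V det_Vandermonde; apply/prodf_neq0 => i _; apply/prodf_neq0 => j ij.
    rewrite !mxE; case: (leqP (t i) (t j)) => [tij|/ltnW tji].
      rewrite -natrB// padic_natr_eq0 subn_eq0 -ltnNge ltn_neqAle tij andbT.
      by apply: contraTneq ij => /ord_inj/ti ->; rewrite ltnn.
    rewrite -opprB oppr_eq0 -natrB// padic_natr_eq0 subn_eq0 -ltnNge.
    rewrite ltn_neqAle tji andbT.
    by apply: contraTneq ij => /ord_inj/ti ->; rewrite ltnn.
  by move=> /padic_neq0_residue[m Vm]; exists m.
pose mt t := projT1 (cid (Vex t)); have mtP t := projT2 (cid (Vex t)).
exists (\max_t mt t)%N => m m0 t ti.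
pose t' : {ffun 'I_n.+1 -> 'I_N} := [ffun i => t i].
have ti' : injective t' by move=> i j; rewrite !ffunE; exact: ti.
have /mtP := ti'; rewrite -/(mt t').
have -> : V t' = \det (Vandermonde n.+1 (\row_i ((t i)%:R : Zp))).
  by congr (\det (Vandermonde _ _)); apply/matrixP => i j; rewrite !mxE ffunE.
apply: contra_neq; apply: residue_weaken0.
by apply: leq_trans m0; exact: leq_bigmax.
Qed.

(** Modulo p^m a monic polynomial of degree n can have more than n roots, so the roots are taken
    among numbers whose Vandermonde determinants survive modulo p^m. With n + 1 roots, the
    coefficient row u would satisfy u V = 0 modulo p^m; multiplying by the adjugate, the leading
    coefficient 1 gives det V = 0 modulo p^m. *)
Lemma card_roots_padic (N m : nat) (A : 'M[Zp]_n) :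
  (forall t : 'I_n.+1 -> 'I_N, injective t ->
    \det (Vandermonde n.+1 (\row_i ((t i)%:R : Zp))) m != 0%N) ->
  (#|[set t : 'I_N | (\det (A + (t%:R)%:M)) m == 0%N]| <= n)%N.
Proof.
set S := finset _ => VN0; rewrite leqNgt; apply/negP => nS.
pose t (i : 'I_n.+1) : 'I_N := enum_val (widen_ord nS i).
have ti : injective t.
  by move=> i j /enum_val_inj /(congr1 val) /= ij; exact: ord_inj.
have /eqP := VN0 t ti; apply.
set V := Vandermonde _ _.
pose g := char_poly (- A).
have gE (i : 'I_n.+1) : \sum_(l < n.+1) g`_l * V l i = \det (A + ((t i)%:R)%:M).
  rewrite -horner_char_polyN horner_coef size_char_poly.
  by apply: eq_bigr => l _; rewrite !mxE.
pose u : 'rV[Zp]_n.+1 := \row_l g`_l.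
have : u *m V *m \adj V = \det V *: u by rewrite -mulmxA mul_mx_adj mul_mx_scalar.
move=> /matrixP/(_ 0 ord_max); rewrite !mxE /=.
have -> : g`_n = 1.
  by have /monicP := char_poly_monic (- A); rewrite lead_coefE size_char_poly.
rewrite mulr1 => <-; apply: residue_sum0 => i _.
rewrite mulrC residue_mul0// mxE.
under eq_bigr do rewrite mxE.
rewrite gE; apply/eqP.
by have := enum_valP (widen_ord nS i); rewrite inE.
Qed.

End Roots.

End PadicVectors.

(** * Normalised vectors *)

Section Normalized.
Variables (p : nat) (p_pr : prime p) (n : nat).
Local Notation Zp := (padic_int p_pr).
Implicit Types (x y z : 'cV[Zp]_n.+1) (j : 'I_n.+1).

Definition normalized j x : Prop :=
  x j 0 = 1 /\ forall s : 'I_n.+1, (s < j)%N -> x s 0 1%N = 0%N.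

(** The pivot is the first coordinate that divides all the others, which exists since divisibility
    is total. An earlier coordinate with a unit quotient would also divide all of them, against
    minimality. *)
Lemma normalize x : x != 0 -> exists j y, [/\ normalized j y, x j 0 != 0 &
  x = x j 0 *: y].
Proof.
move=> x0.
pose mindvd j := `[< forall s, exists c, x s 0 = c * x j 0 >].
have exj : exists j, mindvd j.
  suff [j jP] : exists j, forall s, s \in enum 'I_n.+1 -> exists c, x s 0 = c * x j 0.
    by exists j; apply/asboolP => s; apply: jP; rewrite mem_enum.
  elim: (enum _) => [|a r [j jP]]; first by exists 0.
  have [[c ac]|[c jc]] := padic_dvd_total (x j 0) (x a 0).
    by exists j => s; rewrite inE => /predU1P[->|/jP//]; exists c.
  exists a => s; rewrite inE => /predU1P[->|/jP[e ->]].
    by exists 1; rewrite mul1r.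
  by exists (e * c); rewrite jc mulrA.
have exn : exists i : nat, [exists j : 'I_n.+1, mindvd j && (j == i :> nat)].
  by have [j jP] := exj; exists j; apply/existsP; exists j; rewrite jP eqxx.
case: (ex_minnP exn) => i /existsP[j /andP[/asboolP jP /eqP <-]] jmin.
pose c s := projT1 (cid (jP s)); have cP s : x s 0 = c s * x j 0 := projT2 (cid (jP s)).
have xj0 : x j 0 != 0.
  apply: contra_neq x0 => xj; apply/matrixP => s u; rewrite ord1 mxE.
  by rewrite cP xj mulr0.
exists j, (\col_s c s); split => //; last first.
  by apply/matrixP => s u; rewrite ord1 !mxE cP mulrC.
split; first by rewrite mxE; apply: (mulIf xj0); rewrite -cP mul1r.
move=> s sj; rewrite mxE; apply/eqP/negPn/negP => /padic_unit_residue cU.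
have : (j <= s)%N.
  apply: jmin; apply/existsP; exists s; rewrite eqxx andbT; apply/asboolP => u.
  by exists (c u / c s); rewrite (cP s) mulrA divrK.
by rewrite leqNgt sj.
Qed.

(** Reading y = c x modulo p at the pivot of y, neither c nor x vanishes there, so j <= j'. At the
    pivot of x, y is c, nonzero modulo p, so j' <= j. At the common pivot the relation becomes c = 1
    modulo p^(k+1). *)
Lemma normalized_uniq_mod (j j' : 'I_n.+1) x y (c : Zp) k :
  normalized j x -> normalized j' y ->
  (forall s, y s 0 k.+1 = (c * x s 0) k.+1) ->
  j = j' /\ forall s, y s 0 k.+1 = x s 0 k.+1.
Proof.
move=> [xj xlt] [yj ylt] yx.
have yx1 s : y s 0 1%N = (c * x s 0) 1%N by apply: residue_weaken (yx s).
have nz1 : (1 : Zp) 1%N <> 0%N.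
  by rewrite residue1 expn1 modn_small// prime_gt1.
have := yx1 j'; rewrite yj => cx.
have c1 : c 1%N <> 0%N by move=> c1; apply: nz1; rewrite cx mulrC residue_mul0.
have xj'1 : x j' 0 1%N <> 0%N by move=> x1; apply: nz1; rewrite cx residue_mul0.
have jj' : (j <= j')%N by rewrite leqNgt; apply/negP => /xlt.
have j'j : (j' <= j)%N.
  rewrite leqNgt; apply/negP => /ylt; rewrite yx1 xj mulr1; exact: c1.
have ejj : j = j' by apply: ord_inj; apply/eqP; rewrite eqn_leq jj' j'j.
split=> // s; rewrite yx.
have := yx j; rewrite {1}ejj yj xj mulr1 => cE.
by rewrite residueM -cE -residueM mul1r.
Qed.

(** One scalar is a multiple of the other. After cancelling, one vector is a multiple of the other,
    and the previous lemma applies at every level. *)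
Lemma normalized_scale_inj (j j' : 'I_n.+1) x y (c e : Zp) :
  normalized j x -> normalized j' y -> c != 0 -> c *: x = e *: y ->
  j = j' /\ x = y.
Proof.
move=> nx ny c0.
have key i i' (u v : 'cV[Zp]_n.+1) (a b d : Zp) : normalized i u -> normalized i' v ->
    b != 0 -> a = d * b -> a *: u = b *: v -> i = i' /\ v = u.
  move=> nu nv b0 -> uv.
  have vu s : v s 0 = d * u s 0.
    move/matrixP/(_ s 0) : uv; rewrite !mxE mulrAC [d * _ * b]mulrC.
    by move/(mulfI b0).
  have H k : i = i' /\ forall s, v s 0 k.+1 = u s 0 k.+1.
    by apply: (normalized_uniq_mod (c := d) nu nv) => s; rewrite vu.
  split; first by have [] := H 0%N.
  apply/matrixP => s z; rewrite ord1; apply: padicP => -[|k].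
    by rewrite !residue_at0.
  by have [_ ->] := H k.
move=> xy.
have e0 : e != 0.
  apply: contra_neq c0 => e0; move/matrixP/(_ j 0) : xy.
  by rewrite e0 scale0r !mxE (proj1 nx) mulr1.
have [[d ed]|[d cd]] := padic_dvd_total c e.
  by have [-> ->] := key _ _ _ _ _ _ _ ny nx c0 ed (esym xy).
by have [-> ->] := key _ _ _ _ _ _ _ nx ny e0 cd xy.
Qed.

End Normalized.

(** * Counting matrices modulo powers of p *)

Section MatrixCounting.
Variables (p : nat) (p_pr : prime p) (n : nat).
Local Notation Zp := (padic_int p_pr).
Local Notation "'R_ k" := ('Z_(p ^ k.+1)) (at level 8, k at level 2).
Local Notation M K := 'M['Z_(p ^ K.+1)]_(n, n.+1).
Implicit Types (j : 'I_n.+1).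

(** Divisibility by p^m in Z/p^(K+1) is tested on a lift; for m <= K + 1 the choice of lift does not
    matter, by [lift_red_residue]. *)
Definition det_vanishes K m j (A : M K) : bool :=
  lift_red p_pr (\det (col' j A)) m == 0%N.

Definition col_vanishes K c j (A : M K) : bool :=
  [forall i, lift_red p_pr (A i j) c == 0%N].

Lemma lift_red_residue K m (x : Zp) : (m <= K.+1)%N ->
  lift_red p_pr (red K x) m = x m.
Proof. by move=> mK; apply: (residue_weaken mK); apply/red_eq; rewrite lift_redK. Qed.

Definition shift_mx K j (t : nat) (r : 'I_n -> nat) : M K :=
  \matrix_(i, s) (if unlift j s is Some l then (t%:R *+ (i == l)) else (r i)%:R).

Lemma col'_shift_mx K j t r : col' j (shift_mx K j t r) = t%:R%:M.
Proof. by apply/matrixP => i s; rewrite !mxE liftK. Qed.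

(* Double counting over the N p^(cn) translates A + T, T having the scalar
   matrix t outside column j and r in column j: a given A is sent into the set by
   at most one r and n values of t. *)
Lemma card_vanishes N : exists m0, forall K c m j,
  (m0 <= m)%N -> (m <= K.+1)%N -> (c <= K.+1)%N ->
  (N * p ^ (c * n) * #|[set A : M K | col_vanishes c j A && det_vanishes m j A]|
   <= n * #|{: M K}|)%N.
Proof.
have [m0 m0P] := vandermonde_padic p_pr n N.
exists m0 => K c m j mm0 mK cK.
set B := finset _.
have -> : (N * p ^ (c * n))%N = #|{: 'I_N * {ffun 'I_n -> 'I_(p ^ c)}}|.
  by rewrite card_prod card_ffun !card_ord expnM.
pose T (a : 'I_N * {ffun 'I_n -> 'I_(p ^ c)}) := shift_mx K j a.1 (fun i => a.2 i).
have -> : (#|{: 'I_N * {ffun 'I_n -> 'I_(p ^ c)}}| * #|B| =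
    \sum_a \sum_(A : M K) ((A + T a)%R \in B))%N.
  rewrite -sum_nat_const; apply: eq_big => // a _.
  rewrite -sum1_card big_mkcond /= (reindex_inj (addIr (T a))) /=.
  by apply: eq_bigr => A _; case: ifP.
rewrite exchange_big /= mulnC -sum_nat_const; apply: leq_sum => A _.
rewrite -big_mkcond /= sum1dep_card.
pose A' : 'M[Zp]_n := map_mx (lift_red p_pr (k:=K)) (col' j A).
apply: leq_trans (card_roots_padic A' (m0P _ mm0)).
have entry t r i : (A + T (t, r)) i j =
    red K (lift_red p_pr (A i j) + (r i)%:R).
  by rewrite !mxE /= unlift_none rmorphD /= lift_redK rmorph_nat.
rewrite -(@card_in_imset _ _ (fun a => a.1)); last first.
  move=> [t r] [t' r']; rewrite !inE /=.
  move=> /andP[/forallP rP _] /andP[/forallP r'P _] tt'.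
  rewrite -tt'; congr pair; apply/ffunP => i.
  move: (rP i) (r'P i); rewrite !entry !lift_red_residue// => /eqP r0 /eqP r'0.
  have /residueB0 : ((r i)%:R - (r' i)%:R : Zp) c = 0%N.
    rewrite (_ : _ - _ = lift_red p_pr (A i j) + (r i)%:R
      - (lift_red p_pr (A i j) + (r' i)%:R)); last by ring.
    by apply/residueB0; rewrite r0 r'0.
  by rewrite !residue_nat !modn_small// => rr; exact: ord_inj.
apply: subset_leq_card; apply/fintype.subsetP => _ /imsetP[[t r] + ->] /=.
rewrite !inE => /andP[_ /eqP dt].
apply/eqP; rewrite -[RHS]dt -(lift_red_residue _ mK); congr (lift_red _ _ _).
rewrite -det_map_mx map_mxD map_scalar_mx /= rmorph_nat; congr (\det _).
apply/matrixP => i l; rewrite !mxE lift_redK; congr (_ + _).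
by rewrite liftK mulrnAC.
Qed.


Lemma map_mx_lift_redK K a b (A : 'M['R_K]_(a, b)) :
  map_mx (red K) (map_mx (lift_red p_pr (k:=K)) A) = A.
Proof. by apply/matrixP => i u; rewrite !mxE lift_redK. Qed.

Lemma map_red_eq0 K a b (A : 'M[Zp]_(a, b)) :
  map_mx (red K) A = 0 <-> forall i u, A i u K.+1 = 0%N.
Proof.
split=> [A0 i u|A0]; first by apply/red_eq0; move/matrixP/(_ i u) : A0; rewrite !mxE.
by apply/matrixP => i u; rewrite !mxE; exact/red_eq0.
Qed.

Lemma det_vanishesE K m j (A : 'M[Zp]_(n, n.+1)) : (m <= K.+1)%N ->
  det_vanishes m j (map_mx (red K) A) = (\det (col' j A) m == 0%N).
Proof. by move=> mK; rewrite /det_vanishes -map_col' det_map_mx lift_red_residue. Qed.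

Lemma mulmx_col' (R : pzRingType) (A : 'M[R]_(n, n.+1)) j (w : 'cV_n.+1) i :
  (A *m w) i 0 = A i j * w j 0 + (col' j A *m row' j w) i 0.
Proof.
rewrite !mxE (bigD1_ord j) //=; congr (_ + _).
by apply: eq_bigr => l _; rewrite !mxE.
Qed.

(* K.+1 = 2 k.+1: balls are taken modulo P = p^(k+1) and matrices modulo P^2. *)
Variable k : nat.
Local Notation K := (k + k.+1)%N.

Definition kernel_in_ball (jb : 'I_n.+1 * 'cV['R_k]_n.+1) (A : M K) : bool :=
  `[< exists x : 'cV[Zp]_n.+1, [/\ normalized jb.1 x, map_mx (red k) x = jb.2 &
    A *m map_mx (red K) x = 0] >] && ~~ det_vanishes k.+1 jb.1 A.

(** For kernel vectors x and y, the vector w = y - y_j x has w_j = 0, so L w = 0 modulo P^2, where L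
    is A without column j. Then det L w = 0 modulo P^2, and as P does not divide det L, w = 0 modulo
    P. This loss of half the precision is why matrices are taken modulo P^2. *)
Lemma kernel_in_ball_uniq A jb jb' :
  kernel_in_ball jb A -> kernel_in_ball jb' A -> jb = jb'.
Proof.
case: jb jb' => [j b] [j' b'] /andP[/asboolP[x /= [nx <- Ax]] dj].
move=> /andP[/asboolP[y /= [ny <- Ay]] _].
pose A' := map_mx (lift_red p_pr (k:=K)) A.
have AA' : A = map_mx (red K) A' by rewrite map_mx_lift_redK.
pose w := y - y j 0 *: x.
have wj : w j 0 = 0 by rewrite !mxE (proj1 nx) mulr1 subrr.
have Lw i : (col' j A' *m row' j w) i 0 K.+1 = 0%N.
  have -> : (col' j A' *m row' j w) i 0 = (A' *m w) i 0.
    by rewrite (mulmx_col' A' j) wj mulr0 add0r.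
  move: i 0; apply/map_red_eq0; rewrite map_mxM -AA' map_mxB map_mxZ.
  by rewrite mulmxBr -scalemxAr Ax Ay scaler0 subrr.
have dw l : row' j w l 0 k.+1 = 0%N.
  apply: (@residue_mul_cancel _ _ (\det (col' j A'))).
    by move: dj; rewrite AA' det_vanishesE// leqW// leq_addl.
  have -> : \det (col' j A') * row' j w l 0 =
      (\adj (col' j A') *m (col' j A' *m row' j w)) l 0.
    by rewrite mulmxA mul_adj_mx mul_scalar_mx [RHS]mxE.
  by rewrite mxE; apply: residue_sum0 => i _; rewrite residue_mul0 ?Lw.
have [s|-> yx] := normalized_uniq_mod (c := y j 0) (k := k) nx ny.
  apply/residueB0; case: (unliftP j s) => [l ->|->].
    by have := dw l; rewrite !mxE.
  by have := congr1 (fun z : Zp => z k.+1) wj; rewrite !mxE residue0.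
congr pair; apply/matrixP => s u; rewrite !mxE (ord1 u); apply/red_eq.
by rewrite yx.
Qed.

(** The kernel vector is the normalisation y of the vector D of signed maximal minors. With pivot i,
    D = D_i y, so if P divided the minor i it would divide the minor j too. *)
Lemma kernel_in_ball_ex A j : ~~ det_vanishes k.+1 j A ->
  exists jb, kernel_in_ball jb A.
Proof.
pose A' := map_mx (lift_red p_pr (k:=K)) A.
have AA' : A = map_mx (red K) A' by rewrite map_mx_lift_redK.
have kK : (k.+1 <= K.+1)%N := leqW (leq_addl k k.+1).
pose D : 'cV[Zp]_n.+1 := \col_s ((-1) ^+ s * \det (col' s A')).
have Dd s : D s 0 k.+1 = 0%N -> det_vanishes k.+1 s A.
  rewrite AA' det_vanishesE// mxE => Ds; apply/eqP.
  rewrite -[\det _]mul1r -(sqrr_sign _ s) expr2 -mulrA.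
  by rewrite residue_mul0.
move=> dj; have D0 : D != 0.
  by apply: contraNneq dj => D0; apply: Dd; rewrite D0 mxE residue0.
have [i [y [ny Di Dy]]] := normalize D0.
exists (i, map_mx (red k) y); apply/andP; split => /=; last first.
  apply: contra dj; rewrite AA' det_vanishesE// => /eqP di.
  rewrite -AA'; apply: Dd; rewrite Dy mxE mulrC residue_mul0// mxE residue_mul0//.
apply/asboolP; exists y; split=> //; rewrite AA' -map_mxM.
rewrite [A' *m y](_ : _ = 0) ?map_mx0//.
(* The scalar D_i cancels because the relation A' D = 0 holds exactly, over the domain Z_p, for the
   lift A'. *)
have := mulmx_minors A'; rewrite -/D Dy -scalemxAr.
move=> Dy0; apply/matrixP => a b; move/matrixP/(_ a b)/eqP : Dy0.
by rewrite [X in X == _]mxE [X in _ == X]mxE mulf_eq0 (negPf Di) => /eqP ->; rewrite mxE.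
Qed.

Lemma sum_card_kernel_in_ball :
  (\sum_jb #|[set A | kernel_in_ball jb A]| =
   #|[set A : M K | [exists j, ~~ det_vanishes k.+1 j A]]|)%N.
Proof.
under eq_bigr do rewrite -sum1dep_card big_mkcond /=.
rewrite exchange_big /= -sum1dep_card [RHS]big_mkcond /=.
apply: eq_bigr => A _; case: ifP => [/existsP[j /kernel_in_ball_ex[jb Ajb]]|noj].
  rewrite -big_mkcond /= (big_pred1 jb)// => jb'; apply/idP/eqP => [|-> //].
  by move=> h; exact: kernel_in_ball_uniq h Ajb.
rewrite big1// => -[j b] _; case: ifP => // /andP[_ dj].
by move/existsP: noj; case; exists j.
Qed.

(** Here z = e_j + P h, so for a jet with column a and matrix L the equation reads a + P L h = 0
    modulo P^2: the linearised system. *)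
Definition solvable_at j (A : M K) : bool :=
  `[< exists z : 'cV[Zp]_n.+1, [/\ z j 0 = 1, forall s, s != j -> z s 0 k.+1 = 0%N &
    A *m map_mx (red K) z = 0] >] && ~~ det_vanishes k.+1 j A.

Definition set_col j (A : M K) (v : 'cV_n) : M K :=
  \matrix_(i, s) if s == j then v i 0 else A i s.

(** The map T replaces column j of A by A x. It is injective since x_j = 1, leaves the minor
    unchanged, and satisfies T(A) z = A (x + (z - e_j)) when z_j = 1, so it carries kernel vectors
    near e_j to kernel vectors near x. *)
Lemma card_solvable_at j (x : 'cV[Zp]_n.+1) : normalized j x ->
  #|[set A | solvable_at j A]| =
  #|[set A | kernel_in_ball (j, map_mx (red k) x) A]|.
Proof.
move=> nx; pose T (A : M K) := set_col j A (A *m map_mx (red K) x).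
have col'T A : col' j (T A) = col' j A.
  by apply/matrixP => i s; rewrite !mxE eq_sym (negPf (neq_lift _ _)).
have colT A i : T A i j = (A *m map_mx (red K) x) i 0 by rewrite mxE eqxx.
have Tinj : injective T.
  move=> A B TAB; have cAB : col' j A = col' j B by rewrite -(col'T A) -(col'T B) TAB.
  apply/matrixP => i s; case: (unliftP j s) => [l ->|->].
    by move/matrixP/(_ i l) : cAB; rewrite !mxE.
  have := colT A i; rewrite TAB colT !(mulmx_col' _ j) cAB.
  by rewrite mxE (proj1 nx) rmorph1 !mulr1 => /addIr.
rewrite -(card_preimset _ Tinj); apply: eq_card => A; rewrite !inE.
rewrite /solvable_at /kernel_in_ball /det_vanishes col'T; congr (_ && _).
have TE (z : 'cV[Zp]_n.+1) : z j 0 = 1 -> T A *m map_mx (red K) z =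
    A *m map_mx (red K) (x + (z - delta_mx j 0)).
  move=> zj; apply/matrixP => i u; rewrite ord1 (mulmx_col' (T A) j) col'T colT.
  rewrite [map_mx _ z j 0]mxE zj rmorph1 mulr1 map_mxD mulmxDr [RHS]mxE /=; congr (_ + _).
  rewrite (mulmx_col' A j) -!map_row' !mxE eqxx zj subrr rmorph0 mulr0 add0r.
  apply: eq_bigr => l _; rewrite !mxE eq_sym (negPf (neq_lift _ _)) /=.
  by rewrite subr0.
apply: asbool_equiv_eq; split=> /=.
  move=> [z [zj zs Tz]]; exists (x + (z - delta_mx j 0)).
  have yx s : (x + (z - delta_mx j 0)) s 0 k.+1 = x s 0 k.+1.
    rewrite !mxE residue_add0// eqxx andbT.
    case: (eqVneq s j) => [->|sj]; first by rewrite zj subrr residue0.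
    by rewrite subr0 zs.
  split; [split|..].
  - by rewrite !mxE zj eqxx /= subrr addr0 (proj1 nx).
  - by move=> s sj; rewrite (residue_weaken _ (yx s))// (proj2 nx).
  - by apply/matrixP => s u; rewrite ord1 [LHS]mxE [RHS]mxE; apply/red_eq.
  - by rewrite -TE.
move=> [y [ny yx Ay]]; exists (y - x + delta_mx j 0).
have zj : (y - x + delta_mx j 0) j 0 = 1.
  by rewrite !mxE (proj1 nx) (proj1 ny) subrr add0r eqxx.
split=> //.
  move=> s sj; rewrite !mxE (negPf sj) andFb addr0; apply/residueB0/red_eq.
  by move/matrixP/(_ s 0) : yx; rewrite !mxE.
by rewrite TE// addrK addrC subrK.
Qed.

(** The pivot coordinate being 1, a ball is determined by its pivot and the n other residues. The
    bound serves to sum the error terms over all balls. *)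
Lemma card_balls :
  (#|[set jb : 'I_n.+1 * 'cV['R_k]_n.+1 |
     `[< exists x : 'cV[Zp]_n.+1, normalized jb.1 x /\ map_mx (red k) x = jb.2 >]]|
   <= n.+1 * p ^ (k.+1 * n))%N.
Proof.
have -> : (n.+1 * p ^ (k.+1 * n))%N = #|{: 'I_n.+1 * 'cV['R_k]_n}|.
  by rewrite card_prod card_mx !card_ord muln1 (red_modulus p_pr) expnM.
pose g (jb : 'I_n.+1 * 'cV['R_k]_n.+1) := (jb.1, row' jb.1 jb.2 : 'cV['R_k]_n).
rewrite -(@card_in_imset _ _ g) ?max_card//.
move=> [j b] [j' b']; rewrite !inE => -[x [/= [nx _] <-]].
move=> [y [/= [ny _] <-]]; rewrite /g /= => -[jj' xy].
rewrite -{}jj' in ny xy *.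
congr pair; apply/matrixP => s u; rewrite ord1; case: (unliftP j s) => [l ->|->].
  by move/matrixP/(_ l 0) : xy; rewrite !mxE.
by rewrite !mxE nx ny.
Qed.

End MatrixCounting.

(** * Second-order Taylor expansion *)

Section TaylorIdentities.
Variable R : comPzRingType.
Implicit Types a l q t : R.

Lemma taylor2_addE a1 a2 l1 l2 q1 q2 t :
  a1 + t * l1 + t ^+ 2 * q1 + (a2 + t * l2 + t ^+ 2 * q2) =
  a1 + a2 + t * (l1 + l2) + t ^+ 2 * (q1 + q2).
Proof. by ring. Qed.

Lemma taylor2_mulE a1 a2 l1 l2 q1 q2 t :
  (a1 + t * l1 + t ^+ 2 * q1) * (a2 + t * l2 + t ^+ 2 * q2) =
  a1 * a2 + t * (a2 * l1 + a1 * l2) + t ^+ 2 *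
    (l1 * l2 + (a1 * q2 + a2 * q1)
     + (t * (l1 * q2 + l2 * q1) + t ^+ 2 * (q1 * q2))).
Proof. by ring. Qed.

End TaylorIdentities.

Section Taylor.
Variables (p : nat) (p_pr : prime p) (n : nat).
Local Notation Zp := (padic_int p_pr).

Definition cv_eval (f : mpoly n Zp) (x : 'cV[Zp]_n) : Zp := meval (fun i => x i 0) f.

(** This says that Q is 1-Lipschitz for the p-adic sup norm. *)
Definition residue_compatible (Q : 'cV[Zp]_n -> Zp) : Prop :=
  forall k (x y : 'cV[Zp]_n), (forall i, x i 0 k = y i 0 k) -> Q x k = Q y k.

Lemma residue_compatibleD Q Q' : residue_compatible Q -> residue_compatible Q' ->
  residue_compatible (fun x => Q x + Q' x).
Proof. by move=> cQ cQ' k x y xy; rewrite !residueD (cQ k x y)// (cQ' k x y). Qed.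

Lemma residue_compatibleM Q Q' : residue_compatible Q -> residue_compatible Q' ->
  residue_compatible (fun x => Q x * Q' x).
Proof. by move=> cQ cQ' k x y xy; rewrite !residueM (cQ k x y)// (cQ' k x y). Qed.

Lemma residue_compatible_cst c : residue_compatible (fun=> c).
Proof. by []. Qed.

Lemma residue_compatible_sum (c : 'I_n -> Zp) :
  residue_compatible (fun x => \sum_i c i * x i 0).
Proof.
move=> k x y xy; apply/residueB0; rewrite -sumrB; apply: residue_sum0 => i _.
by rewrite -mulrBr residue_mul0//; apply/residueB0.
Qed.

(** Of the remainder only the Lipschitz property is kept: it is what the Newton iteration needs to
    contract. *)
Definition taylor2 (b : 'cV[Zp]_n) (t : Zp) (f : mpoly n Zp) : Prop :=
  exists2 Q, residue_compatible Q & forall h,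
    cv_eval f (b + t *: h) =
    cv_eval f b + t * (\sum_i cv_eval (mderiv i f) b * h i 0) + t ^+ 2 * Q h.

(** Constants and variables have such an expansion, and sums and products preserve it. *)
Lemma taylor2P b t f : taylor2 b t f.
Proof.
have TC c : taylor2 b t (mpolyC n c).
  exists (fun=> 0); first exact: residue_compatible_cst.
  move=> h; rewrite /cv_eval !mevalC big1 ?mulr0 ?addr0// => i _.
  by rewrite mderivC meval0 mul0r.
have TX i : taylor2 b t (mpolyX Zp (mnm1 i)).
  exists (fun=> 0); first exact: residue_compatible_cst.
  move=> h; rewrite /cv_eval !mevalXU mulr0 addr0 !mxE; congr (_ + _ * _).
  rewrite (bigD1 i)//= big1 ?addr0 => [|l li].
    by rewrite mderivX mnm1E eqxx mevalZ -[X in mnm_sub X](add0m (mnm1 i)) addmK mpolyX0 meval1 !mul1r.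
  by rewrite mderivX mnm1E eq_sym (negPf li) scale0r meval0 mul0r.
have TD f1 f2 : taylor2 b t f1 -> taylor2 b t f2 -> taylor2 b t (f1 + f2).
  move=> [Q1 cQ1 E1] [Q2 cQ2 E2]; exists (fun x => Q1 x + Q2 x).
    exact: residue_compatibleD.
  move=> h; have := E1 h; have := E2 h; rewrite /cv_eval !mevalD => -> ->.
  under [in RHS]eq_bigr do rewrite mderivD mevalD mulrDl.
  by rewrite big_split taylor2_addE.
have TM f1 f2 : taylor2 b t f1 -> taylor2 b t f2 -> taylor2 b t (f1 * f2).
  move=> [Q1 cQ1 E1] [Q2 cQ2 E2].
  pose L (f : mpoly n Zp) (h : 'cV[Zp]_n) : Zp := \sum_i cv_eval (mderiv i f) b * h i 0.
  have cL g : residue_compatible (L g) by exact: residue_compatible_sum.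
  exists (fun h => (L f1 h * L f2 h + (cv_eval f1 b * Q2 h + cv_eval f2 b * Q1 h))
    + (t * (L f1 h * Q2 h + L f2 h * Q1 h) + t ^+ 2 * (Q1 h * Q2 h))).
    by do !(apply: residue_compatibleD || apply: residue_compatibleM).
  move=> h.
  transitivity (cv_eval f1 (b + t *: h) * cv_eval f2 (b + t *: h)); first exact: mevalM.
  have E0 : cv_eval (f1 * f2) b = cv_eval f1 b * cv_eval f2 b by exact: mevalM.
  rewrite E1 E2 E0 taylor2_mulE; congr (_ + t * _ + _).
  rewrite !mulr_sumr -big_split; apply: eq_bigr => i _ /=.
  have -> : cv_eval (mderiv i (f1 * f2)) b =
      cv_eval (mderiv i f1) b * cv_eval f2 b + cv_eval f1 b * cv_eval (mderiv i f2) b.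
    by rewrite mderivM /cv_eval mevalD !mevalM.
  by rewrite mulrDl !mulrA [cv_eval f2 b * _]mulrC.
elim/mpolyind: f => [|c m f _ _ IH]; first by rewrite -mpolyC0; exact: TC.
apply: TD IH; rewrite -mul_mpolyC; apply: (TM _ _ (TC c)).
rewrite mpolyXE_id; apply: (big_ind (taylor2 b t)); first by rewrite -mpolyC1; exact: TC.
  exact: TM.
move=> i _; elim: (m i) => [|e IHe]; first by rewrite expr0 -mpolyC1; exact: TC.
rewrite exprS.
exact: (TM _ _ (TX i) IHe).
Qed.

(** The expansion at b = 0 with t = 1 writes f as a constant plus a linear form plus a Lipschitz
    remainder. *)
Lemma cv_eval_compatible f : residue_compatible (cv_eval f).
Proof.
have [Q cQ fQ] := taylor2P 0 1 f => k x y xy.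
have fE z : cv_eval f z = cv_eval f 0 + (\sum_i cv_eval (mderiv i f) 0 * z i 0) + Q z.
  by rewrite -[in LHS](scale1r z) -[in LHS](add0r (1 *: z)) fQ expr1n !mul1r.
rewrite (fE x) (fE y).
exact: (residue_compatibleD (residue_compatibleD
  (residue_compatible_cst (cv_eval f 0))
  (residue_compatible_sum (fun i => cv_eval (mderiv i f) 0))) cQ) xy.
Qed.

End Taylor.

(** * Zeros in a ball *)

Section BallIdentities.
Variable R : comPzRingType.

Lemma taylor2_eq0 (a x q t : R) : a + t * x + t ^+ 2 * q = 0 -> a = (- x - t * q) * t.
Proof. by move=> /eqP; rewrite -addrA addr_eq0 => /eqP ->; ring. Qed.

(** When x0 solves the linear part up to t^2 e, the zeros of the expansion become the fixed points
    of x = x0 - t (e + q). *)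
Lemma taylor2_newton (a x x0 q e t : R) : a + t * x0 = t ^+ 2 * e ->
  a + t * x + t ^+ 2 * q = t * (x - (x0 - t * (e + q))).
Proof. by move=> /eqP; rewrite eq_sym -subr_eq => /eqP <-; ring. Qed.

End BallIdentities.

Section Balls.
Variables (p : nat) (p_pr : prime p) (n : nat).
Local Notation Zp := (padic_int p_pr).
Local Notation "'R_ k" := ('Z_(p ^ k.+1)) (at level 8, k at level 2).
Variables (j : 'I_n.+1) (F : 'I_n -> mpoly n.+1 Zp).

(** A cluster point of the approximate zeros agrees modulo p^m with one of index at least m, so F
    vanishes there modulo p^m, for every m. *)
Lemma zero_in_ball_compact k (b : 'cV['R_k]_n.+1) :
  (forall m, exists x : 'cV[Zp]_n.+1, [/\ normalized j x, map_mx (red k) x = b &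
     forall i, cv_eval (F i) x m = 0%N]) ->
  exists x : 'cV[Zp]_n.+1, [/\ normalized j x, map_mx (red k) x = b &
    forall i, cv_eval (F i) x = 0].
Proof.
move=> ex; pose u m := projT1 (cid (ex m)).
have uP m : [/\ normalized j (u m), map_mx (red k) (u m) = b &
     forall i, cv_eval (F i) (u m) m = 0%N] := projT2 (cid (ex m)).
have [y yP] := padic_cluster (fun m s => u m s 0).
exists (\col_s y s); split.
- split.
    rewrite mxE; apply: padicP => m; have [l _ <-] := yP m 0%N.
    by have [[-> _] _ _] := uP l.
  move=> s sj; rewrite mxE; have [l _ <-] := yP 1%N 0%N.
  by have [[_ H] _ _] := uP l; exact: H.
- have [l _ yl] := yP k.+1 0%N; have [_ <- _] := uP l.
  by apply/matrixP => s z; rewrite (ord1 z) !mxE; apply/red_eq.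
- move=> i; apply: padic_eq0P => m; have [l ml yl] := yP m m.
  have [_ _ /(_ i)/(residue_weaken0 ml) ul0] := uP l.
  by rewrite -[RHS]ul0; apply: cv_eval_compatible => s; rewrite mxE.
Qed.

(** Since h_j = 0, the derivative along the pivot drops out of the expansion; its column holds the
    value at b instead. *)
Definition jet (b : 'cV[Zp]_n.+1) : 'M[Zp]_(n, n.+1) :=
  \matrix_(i, s) if s == j then cv_eval (F i) b else cv_eval (mderiv s (F i)) b.

Variables (b : 'cV[Zp]_n.+1) (k : nat).
Local Notation K := (k + k.+1)%N.
Local Notation P := (p%:R ^+ k.+1 : Zp).

Lemma jet_taylor : exists2 Q : 'I_n -> 'cV[Zp]_n.+1 -> Zp,
  forall i, residue_compatible (Q i) &
  forall (h : 'cV[Zp]_n.+1) i, h j 0 = 0 ->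
    cv_eval (F i) (b + P *: h) =
    jet b i j + P * (col' j (jet b) *m row' j h) i 0 + P ^+ 2 * Q i h.
Proof.
have /boolp.choice[Q QP] (i : 'I_n) : exists Q, residue_compatible Q /\ forall h,
    cv_eval (F i) (b + P *: h) = cv_eval (F i) b
      + P * (\sum_s cv_eval (mderiv s (F i)) b * h s 0) + P ^+ 2 * Q h.
  by have [Q cQ QE] := taylor2P b P (F i); exists Q.
exists Q => [i|h i hj]; first by have [] := QP i.
have [_ ->] := QP i; congr (_ + P * _ + _); first by rewrite mxE eqxx.
rewrite (bigD1_ord j) //= hj [X in X + _]mulr0 add0r [RHS]mxE.
by apply: eq_bigr => l _; rewrite !mxE eq_sym (negPf (neq_lift _ _)).
Qed.

(* A zero x = b + P h gives J (e_j + P h) = - P^2 Q(h), hence a solution of the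
   linearised system modulo P^2. *)
Lemma zero_in_ball_solvable (x : 'cV[Zp]_n.+1) : normalized j b -> normalized j x ->
  map_mx (red k) x = map_mx (red k) b -> (forall i, cv_eval (F i) x = 0) ->
  solvable_at p_pr j (map_mx (red K) (jet b)) ||
  (col_vanishes p_pr k.+1 j (map_mx (red K) (jet b)) &&
   det_vanishes p_pr k.+1 j (map_mx (red K) (jet b))).
Proof.
set J := map_mx (red K) _; move=> nb nx xb Fx; have [Q cQ QE] := jet_taylor.
have /boolp.choice[h0 h0P] (s : 'I_n.+1) : exists h, x s 0 - b s 0 = P * h.
  apply/residue_dvdP/residueB0/red_eq.
  by move/matrixP/(_ s 0) : xb; rewrite !mxE.
pose h : 'cV[Zp]_n.+1 := \col_s h0 s.
have xE : x = b + P *: h.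
  by apply/matrixP => s u; rewrite (ord1 u) !mxE -h0P addrC subrK.
have hj : h j 0 = 0.
  apply: (mulfI (padic_pexp_neq0 p_pr k.+1)).
  by rewrite mulr0 mxE -h0P (proj1 nb) (proj1 nx) subrr.
have E i : jet b i j + P * (col' j (jet b) *m row' j h) i 0 + P ^+ 2 * Q i h = 0.
  by rewrite -QE// -xE Fx.
have [dJ|dJ] := boolP (det_vanishes p_pr k.+1 j J); last first.
  rewrite /solvable_at dJ andbT; apply/orP; left; apply/asboolP.
  exists (delta_mx j 0 + P *: h); split.
  - by rewrite mxE [X in _ + X]mxE hj mulr0 addr0 mxE !eqxx.
  - move=> s sj; rewrite mxE [X in X + _]mxE (negPf sj) andFb add0r mxE.
    by rewrite mulrC residue_mul0 // residue_pexp.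
  rewrite -map_mxM; apply/map_red_eq0 => i u; rewrite (ord1 u).
  have -> : (jet b *m (delta_mx j 0 + P *: h)) i 0 = - (P ^+ 2 * Q i h).
    apply/eqP; rewrite -addr_eq0 -(E i); apply/eqP; congr (_ + _).
    rewrite mulmxDr -scalemxAr -colE mxE [X in X + _]mxE [X in _ + X]mxE.
    by rewrite (mulmx_col' (jet b) j h) hj [X in _ * (X + _)]mulr0 add0r.
  rewrite -mulrN mulrC residue_mul0// -exprM residue_pexp//.
  by rewrite muln2 -addnn.
(* When P divides det L, the zero still forces a = - P (L h + P Q(h)), so column j vanishes modulo
   P. *)
apply/orP; right; rewrite andbT; apply/forallP => i; apply/eqP.
have kK : (k.+1 <= K.+1)%N := leqW (leq_addl k k.+1).
rewrite mxE lift_red_residue//.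
have -> : jet b i j = (- ((col' j (jet b) *m row' j h) i 0) - P * Q i h) * P.
  exact: taylor2_eq0 (E i).
by rewrite residue_mul0// residue_pexp.
Qed.

Lemma residue_pmul (x : Zp) m : x m = 0%N -> (p%:R * x) m.+1 = 0%N.
Proof.
move=> /residue_dvdP[y ->]; rewrite mulrA -exprS mulrC residue_mul0//.
exact: residue_pexp.
Qed.

(* With P = det L p eps, the map G y = h0 - p eps adj(L) q(y) contracts, and
   f(b + P y) = P L (y - G y), so the iterates of G are approximate zeros. *)
Lemma solvable_zero_in_ball : normalized j b ->
  solvable_at p_pr j (map_mx (red K) (jet b)) ->
  exists x : 'cV[Zp]_n.+1, [/\ normalized j x, map_mx (red k) x = map_mx (red k) b &
    forall i, cv_eval (F i) x = 0].
Proof.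
move=> nb /andP[/asboolP[z [zj zs Jz]] dJ]; have [Q cQ QE] := jet_taylor.
have kK : (k.+1 <= K.+1)%N := leqW (leq_addl k k.+1).
move: dJ; rewrite det_vanishesE// => /residue_ndvd[eps Pd].
set L := col' j (jet b) in Pd; set d := \det L in Pd.
have /boolp.choice[h hP] (l : 'I_n) : exists h, z (lift j l) 0 = P * h.
  by apply/residue_dvdP/zs; rewrite eq_sym neq_lift.
have /boolp.choice[e eP] (i : 'I_n) : exists e, (jet b *m z) i 0 = P ^+ 2 * e.
  rewrite -exprM muln2 -addnn; apply/residue_dvdP.
  by move: i (0 : 'I_1); apply/map_red_eq0; rewrite map_mxM.
pose h0 : 'cV[Zp]_n := \col_l h l.
have zE i : jet b i j + P * (L *m h0) i 0 = P ^+ 2 * e i.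
  rewrite -eP (mulmx_col' (jet b) j) zj mulr1 -/L; congr (_ + _).
  by rewrite !mxE mulr_sumr; apply: eq_bigr => l _; rewrite !mxE hP mulrCA.
pose H (y : 'cV[Zp]_n) : 'cV[Zp]_n.+1 :=
  \col_s if unlift j s is Some l then y l 0 else 0.
have Hj y : H y j 0 = 0 by rewrite mxE unlift_none.
have rH y : row' j (H y) = y.
  by apply/matrixP => l u; rewrite (ord1 u) !mxE liftK.
(* Here e is the error of the approximate solution h0, namely a + P L h0 = P^2 e, and q adds the
   Taylor remainder to it. *)
pose q (y : 'cV[Zp]_n) : 'cV[Zp]_n := \col_i (e i + Q i (H y)).
pose G (y : 'cV[Zp]_n) : 'cV[Zp]_n := h0 - (p%:R * eps) *: (\adj L *m q y).
have LG y : L *m G y = L *m h0 - P *: q y.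
  rewrite mulmxBr -scalemxAr mulmxA mul_mx_adj mul_scalar_mx scalerA -/d.
  by rewrite Pd [d * _]mulrC.
have FE y i : cv_eval (F i) (b + P *: H y) = P * ((L *m (y - G y)) i 0).
  rewrite (QE _ _ (Hj y)) rH -/L (taylor2_newton _ _ (zE i)) mulmxBr LG.
  by rewrite [in RHS]mxE [X in _ = _ * (_ + X)]mxE [X in _ = _ * (_ - X)]mxE
    [X in _ = _ * (_ - (_ + X))]mxE [X in _ = _ * (_ - (_ - X))]mxE
    [X in _ = _ * (_ - (_ - _ * X))]mxE.
have Gc m (y y' : 'cV[Zp]_n) : (forall l, y l 0 m = y' l 0 m) -> forall l, G y l 0 m.+1 = G y' l 0 m.+1.
  move=> yy' l; apply/residueB0.
  have -> : G y l 0 - G y' l 0 = p%:R * (eps * (\adj L *m (q y' - q y)) l 0).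
    have GB : G y - G y' = (p%:R * eps) *: (\adj L *m (q y' - q y)).
      by rewrite /G opprB addrC subrKA mulmxBr scalerBr.
    transitivity ((G y - G y') l 0); first by rewrite [RHS]mxE [X in _ = _ + X]mxE.
    by rewrite GB mxE mulrA.
  apply: residue_pmul; rewrite residue_mul0// mxE; apply: residue_sum0 => i _.
  rewrite residue_mul0// !mxE opprD addrACA [X in X + _]subrr add0r.
  apply/residueB0.
  apply: cQ => s; rewrite !mxE; case: unliftP => [l' _|_]; last by [].
  exact/esym/yy'.
pose y m := iter m G h0.
have yc m : forall l, y m l 0 m = y m.+1 l 0 m.
  elim: m => [|m IH] l; first by rewrite !residue_at0.
  exact: Gc.
apply: zero_in_ball_compact => m; exists (b + P *: H (y m)).
have bx s : (b + P *: H (y m)) s 0 k.+1 = b s 0 k.+1.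
  rewrite mxE residue_add0// mxE mulrC residue_mul0//.
  exact: residue_pexp.
split; [split|..].
- by rewrite mxE [X in _ + X]mxE Hj mulr0 addr0 (proj1 nb).
- by move=> s sj; rewrite (residue_weaken _ (bx s))// (proj2 nb).
- by apply/matrixP => s u; rewrite (ord1 u) [LHS]mxE [RHS]mxE; apply/red_eq.
move=> i; rewrite FE residue_mul0// mxE; apply: residue_sum0 => l _.
rewrite residue_mul0// mxE [X in _ + X]mxE; apply/residueB0; exact: yc.
Qed.

End Balls.

(** * Counting as a limit *)

Lemma map_uniq_inj_in (T1 T2 : eqType) (f : T1 -> T2) (s : seq T1) :
  uniq (map f s) -> {in s &, injective f}.
Proof.
elim: s => //= a s IH /andP[fa us] x y; rewrite !inE.
move=> /predU1P[->|xs] /predU1P[->|ys]//; last exact: IH.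
- by move=> e; move: fa; rewrite e map_f.
- by move=> e; move: fa; rewrite -e map_f.
Qed.

Section CountingLimit.
Local Open Scope classical_set_scope.
Local Open Scope ereal_scope.
Context (R : realType) (T : choiceType) (V : nat -> finType)
  (rho : forall k, T -> V k).
Hypothesis rho_coarser : forall k x y, rho k.+1 x = rho k.+1 y -> rho k x = rho k y.
Hypothesis rho_separates : forall x y, x <> y -> exists k, rho k x <> rho k y.
Variable S : set T.

Lemma rho_coarser_le k l x y : (k <= l)%N -> rho l x = rho l y -> rho k x = rho k y.
Proof.
elim: l => [|l IH]; first by rewrite leqn0 => /eqP ->.
by rewrite leq_eqVlt => /predU1P[->//|]; rewrite ltnS => /IH + /rho_coarser.
Qed.

Definition approx_count k : nat :=
  #|[pred v : V k | `[< exists2 x, S x & rho k x = v >]]|.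

Lemma approx_count_ge (k : nat) (s : seq T) : (forall x, x \in s -> S x) ->
  uniq (map (rho k) s) -> (size s <= approx_count k)%N.
Proof.
move=> sS us; rewrite -(size_map (rho k)) -(card_uniqP us).
apply: subset_leq_card; apply/fintype.subsetP => _ /mapP[x xs ->].
by rewrite inE; exists x => //; exact: sS.
Qed.

Lemma approx_count_rep k : exists s : seq T, [/\ (forall x, x \in s -> S x),
  uniq (map (rho k) s) & size s = approx_count k].
Proof.
pose A := [pred v : V k | `[< exists2 x, S x & rho k x = v >]].
(* The choice of representatives takes a default point on the cells that miss S, hence the separate
   case of an empty type. *)
have [x0|noT] := pselect (exists x : T, True); last first.
  exists [::]; split=> //; apply/esym/eqP; rewrite -leqn0 leqNgt; apply/negP.
  by move=> /card_gt0P[v]; rewrite inE => -[x _ _]; apply: noT; exists x.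
have /boolp.choice[g gP] (v : V k) : exists x, v \in A -> S x /\ rho k x = v.
  have [/asboolP[x Sx xv]|] := boolP (v \in A); first by exists x.
  by have [x _] := x0; exists x.
exists (map g (enum A)); split.
- by move=> _ /mapP[v + ->]; rewrite mem_enum => /gP[].
- rewrite -map_comp (_ : map _ _ = enum A) ?enum_uniq//.
  by rewrite -[RHS]map_id; apply/eq_in_map => v; rewrite mem_enum => /gP[].
- by rewrite size_map -cardE.
Qed.

(** Representatives of distinct cells stay in distinct cells at a finer level. *)
Lemma approx_count_nondecreasing k l : (k <= l)%N ->
  (approx_count k <= approx_count l)%N.
Proof.
move=> kl; have [s [sS us <-]] := approx_count_rep k; apply: approx_count_ge => //.
rewrite map_inj_in_uniq ?(map_uniq us)// => x y xs ys /(rho_coarser_le kl).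
exact: (map_uniq_inj_in us).
Qed.

(** The level is the maximum, over the finitely many pairs, of a level separating the pair. *)
Lemma separated_level (s : seq T) : uniq s -> exists k, uniq (map (rho k) s).
Proof.
move=> us.
have /boolp.choice[h hP] (xy : T * T) : exists k, xy.1 <> xy.2 -> rho k xy.1 <> rho k xy.2.
  have [->|/rho_separates[k kxy]] := pselect (xy.1 = xy.2); first by exists 0%N.
  by exists k.
exists (\max_(xy <- [seq (x, y) | x <- s, y <- s]) h xy)%N.
rewrite map_inj_in_uniq// => x y xs ys xy; apply/eqP/negPn/negP => /eqP /(hP (x, y)); apply.
by apply: rho_coarser_le xy; apply: leq_bigmax_seq => //; exact: allpairs_f.
Qed.

(** Both sides are the supremum of the lengths of duplicate-free sequences in S: each such sequence
    is separated at some level, and each level count is the length of one. An infinite S has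
    arbitrarily large finite subsets. *)
Lemma counting_approx : (approx_count k)%:R%:E @[k --> \oo] --> (counting S : \bar R).
Proof.
have -> : counting S = ereal_sup (range (fun k => (approx_count k)%:R%:E : \bar R)).
  apply/eqP; rewrite eq_le; apply/andP; split.
    have ub (s : seq T) : uniq s -> (forall x, x \in s -> S x) ->
        (size s)%:R%:E <= ereal_sup (range (fun k => (approx_count k)%:R%:E : \bar R)).
      move=> us sS; have [k usk] := separated_level us.
      apply: (@le_trans _ _ (approx_count k)%:R%:E).
        by rewrite lee_fin ler_nat approx_count_ge.
      by apply: ereal_sup_ubound; exists k.
    rewrite /counting; case: asboolP => [fS|iS].
      apply: ub; first exact: finmap.fset_uniq.
      by move=> x; rewrite in_fset_set// => /set_mem.
    rewrite leye_eq; apply/eqP/eqyP => A A0.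
    have [B BS] := infinite_set_fset (Num.bound A) iS; move=> AB.
    apply: le_trans (ub _ (finmap.fset_uniq B) BS).
    by rewrite lee_fin (le_trans (ltW (archi_boundP (ltW A0))))// ler_nat.
  apply: ge_ereal_sup => _ [k _ <-].
  rewrite /counting; case: asboolP => [fS|iS]; last exact: leey.
  rewrite lee_fin ler_nat; have [s [sS us <-]] := approx_count_rep k.
  apply: uniq_leq_size; first exact: map_uniq us.
  by move=> x /sS Sx; rewrite in_fset_set// mem_set.
apply: ereal_nondecreasing_cvgn => k l kl.
by rewrite lee_fin ler_nat approx_count_nondecreasing.
Qed.

End CountingLimit.

(** * Projective space *)

Lemma fraction_numden (R : idomainType) (a : {fraction R}) :
  exists n d : R, d != 0 /\ a * tofrac d = tofrac n.
Proof.
elim/generic_quotient.quotW: a => x.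
exists (frac x).1, (frac x).2; split; first exact: denom_ratioP.
unlock tofrac; rewrite -[LHS]FracField.pi_mul; apply/generic_quotient.eqmodP => /=.
rewrite FracField.equivfE /FracField.mulf !numden_Ratio ?mulr1 ?oner_neq0 ?denom_ratioP//.
by rewrite mulrC.
Qed.

Lemma meval_map_mpoly (R S : comNzRingType) (phi : {rmorphism R -> S}) n
    (f : mpoly n R) (v : 'I_n -> R) :
  meval (fun s => phi (v s)) (map_mpoly phi f) = phi (meval v f).
Proof.
elim/mpolyind: f => [|c m f _ _ IH]; first by rewrite rmorph0 !meval0 rmorph0.
rewrite rmorphD /= !mevalD IH rmorphD map_mpolyZ !mevalZ rmorphM map_mpolyX !mevalX.
rewrite rmorph_prod; congr (_ * _ + _); apply: eq_bigr => s _.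
by rewrite rmorphXn.
Qed.

Lemma meval_homog_scale (R : comNzRingType) n d (f : mpoly n R) (v : 'I_n -> R) a :
  (forall m : multinom n, mdeg m != d -> mcoeff m f = 0) ->
  meval (fun s => a * v s) f = a ^+ d * meval v f.
Proof.
move=> fd; rewrite !mevalE mulr_sumr; apply: eq_bigr => m _.
have [md|/fd ->] := eqVneq (mdeg m) d; last by rewrite !mul0r mulr0.
rewrite mulrCA; congr (_ * _); rewrite -md mdegE -prodrXr -big_split /=.
by apply: eq_bigr => s _; rewrite exprMn.
Qed.

Section ProjectiveSpace.
Variables (p : nat) (p_pr : prime p) (n : nat).
Local Notation Zp := (padic_int p_pr).
Local Notation Kp := {fraction Zp}.
Local Notation PP := (projective_space Kp n).

Definition frac_row (x : 'cV[Zp]_n.+1) : 'rV[Kp]_n.+1 := \row_s tofrac (x s 0).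

Lemma frac_rowZ c x : frac_row (c *: x) = tofrac c *: frac_row x.
Proof. by apply/matrixP => i s; rewrite !mxE tofracM. Qed.

Lemma frac_row_inj : injective frac_row.
Proof.
move=> x y xy; apply/matrixP => s u; rewrite (ord1 u).
by move/matrixP/(_ 0 s) : xy; rewrite !mxE => /eqP; rewrite tofrac_eq => /eqP.
Qed.

Lemma frac_row_neq0 j x : normalized j x -> frac_row x != 0.
Proof.
move=> [xj _]; apply/eqP => /matrixP/(_ 0 j).
by rewrite !mxE xj tofrac1 => /eqP; rewrite oner_eq0.
Qed.

Lemma frac_row_denom (v : 'rV[Kp]_n.+1) :
  exists d y, d != 0 /\ tofrac d *: v = frac_row y.
Proof.
have /boolp.choice[f fP] (s : 'I_n.+1) :
    exists nd : Zp * Zp, nd.2 != 0 /\ v 0 s * tofrac nd.2 = tofrac nd.1.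
  by have [a [d ad]] := fraction_numden (v 0 s); exists (a, d).
exists (\prod_s (f s).2), (\col_s (\prod_(l | l != s) (f l).2 * (f s).1)).
split; first by apply/prodf_neq0 => s _; have [] := fP s.
apply/matrixP => i s; rewrite (ord1 i) !mxE (bigD1 s)//= !tofracM.
by have [_ <-] := fP s; rewrite -mulrA mulrCA [X in _ * X]mulrC.
Qed.

(** Denominators of a spanning vector are cleared, and the result is divided by its pivot
    coordinate. *)
Lemma projective_normalized (L : PP) :
  exists jx : 'I_n.+1 * 'cV[Zp]_n.+1,
    normalized jx.1 jx.2 /\ sval L = <[frac_row jx.2]>%VS.
Proof.
case: L => L /= /eqP dL.
have v0 : vpick L != 0 by rewrite vpick0 -dimv_eq0 dL.
have Lv : L = <[vpick L]>%VS.
  apply/esym/eqP; rewrite eqEdim dim_vline v0 dL leqnn andbT.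
  by rewrite -memvE memv_pick.
have [d [y [d0 dy]]] := frac_row_denom (vpick L).
have td0 : tofrac d != 0 by rewrite tofrac_eq0.
have y0 : y != 0.
  apply: contra_neq v0 => y0; move: dy; rewrite y0 => /matrixP dy.
  apply/matrixP => i s; move: (dy i s); rewrite !mxE tofrac0 => /eqP.
  by rewrite mulf_eq0 (negPf td0) => /eqP.
have [j [x [nx xj yx]]] := normalize y0.
have tx0 : tofrac (y j 0) != 0 by rewrite tofrac_eq0.
have dyV : vpick L = (tofrac d)^-1 *: frac_row y.
  by rewrite -dy scalerA (mulVf td0) scale1r.
have yxT : frac_row y = tofrac (y j 0) *: frac_row x by rewrite -frac_rowZ -yx.
exists (j, x); split=> //=; rewrite Lv; apply: subv_anti; apply/andP; split.
  rewrite -memvE; apply/vlineP; exists ((tofrac d)^-1 * tofrac (y j 0)).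
  by rewrite dyV yxT scalerA.
rewrite -memvE; apply/vlineP; exists ((tofrac (y j 0))^-1 * tofrac d).
by rewrite -scalerA dy yxT scalerA (mulVf tx0) scale1r.
Qed.

(** Writing the proportionality factor as c / d brings the relation back to d x = c y over Z_p. *)
Lemma frac_row_line_inj j j' x y : normalized j x -> normalized j' y ->
  <[frac_row x]>%VS = <[frac_row y]>%VS -> j = j' /\ x = y.
Proof.
move=> nx ny xy; have : frac_row x \in <[frac_row y]>%VS by rewrite -xy memv_line.
move=> /vlineP[a ax]; have [c [d [d0 ad]]] := fraction_numden a.
apply: (normalized_scale_inj (c := d) (e := c) nx ny d0); apply: frac_row_inj.
by rewrite !frac_rowZ ax scalerA -ad [a * _]mulrC.
Qed.

Lemma projective_of_normalized (j : 'I_n.+1) x : normalized j x ->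
  exists L : PP, sval L = <[frac_row x]>%VS.
Proof.
move=> nx; have d1 : \dim <[frac_row x]>%VS == 1%N.
  by rewrite dim_vline (frac_row_neq0 nx).
by exists (exist (fun L : {vspace 'rV[Kp]_n.+1} => \dim L == 1%N) _ d1).
Qed.

Lemma meval_map_tofrac (f : mpoly n.+1 Zp) (x : 'cV[Zp]_n.+1) :
  meval (fun s => frac_row x 0 s) (map_mpoly (@tofrac Zp) f) = tofrac (cv_eval f x).
Proof.
rewrite /cv_eval -meval_map_mpoly; apply: meval_eq => s.
by rewrite mxE.
Qed.

(** By homogeneity, vanishing at one spanning vector amounts to vanishing on the whole line. *)
Lemma proj_zerosP (I : Type) (d : I -> nat) (f : forall i, dhomog n.+1 Zp (d i))
    (L : PP) j (x : 'cV[Zp]_n.+1) :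
  normalized j x -> sval L = <[frac_row x]>%VS ->
  proj_zeros (fun i => f i : mpoly n.+1 Zp) L <-> forall i, cv_eval (f i) x = 0.
Proof.
move=> nx Lx; split=> [Lf i|fx i v].
  have /Lf-/(_ i) : frac_row x \in sval L by rewrite Lx memv_line.
  by rewrite meval_map_tofrac => /eqP; rewrite tofrac_eq0 => /eqP.
rewrite Lx => /vlineP[a ->].
under meval_eq do rewrite mxE.
rewrite (@meval_homog_scale _ _ (d i)) ?meval_map_tofrac ?fx ?tofrac0 ?mulr0//.
move=> m md; rewrite mcoeff_map_mpoly (dhomog_nemf_coeff _ md) ?tofrac0//.
exact: dhomog_is_dhomog.
Qed.

End ProjectiveSpace.

(** * Equidistribution *)

Section Equidistribution.
Local Open Scope classical_set_scope.
Local Open Scope ereal_scope.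
Context (R : realType) (disp : measure_display) (T : measurableType disp)
  (P : probability T R).

(** The common probability is left unspecified; total mass one forces it to be 1 / #A, as
    [equidistributed_prob] shows. *)
Definition equidistributed (A : finType) (X : T -> A) : Prop :=
  exists c, forall a, measurable [set w | X w = a] /\ P [set w | X w = a] = c.

Section FiniteValued.
Variables (A : finType) (X : T -> A).
Hypothesis mX : forall a, measurable [set w | X w = a].

Lemma finite_valuedE (Q : pred A) :
  [set w | Q (X w)] = \bigcup_(a in [set` enum Q]) [set w | X w = a].
Proof.
apply/seteqP; split=> [w Qw|w [a /= + ->]]; last by rewrite mem_enum.
by exists (X w) => //=; rewrite mem_enum.
Qed.

Lemma finite_valued_measurable (Q : pred A) : measurable [set w | Q (X w)].
Proof. by rewrite finite_valuedE; apply: fin_bigcup_measurable => //; exact: finite_finset. Qed.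

Lemma finite_valued_prob (Q : pred A) :
  P [set w | Q (X w)] = \sum_(a | Q a) P [set w | X w = a].
Proof.
rewrite finite_valuedE measure_fin_bigcup//; last first.
  by move=> a b _ _ [w [/= <- <-]].
by rewrite -fsbig_seq ?enum_uniq// big_enum.
Qed.

End FiniteValued.

Lemma equidistributed_prob (A : finType) (X : T -> A) (Q : pred A) :
  equidistributed X ->
  measurable [set w | Q (X w)] /\
  P [set w | Q (X w)] = (#|Q|%:R / #|A|%:R)%:E.
Proof.
move=> [c cX]; have mX a := (cX a).1; split; first exact: finite_valued_measurable.
(* A probability space is nonempty, so X takes some value. *)
have A0 : (0 < #|A|)%N.
  rewrite lt0n; apply/negP => /eqP A0; have := probability_setT P.
  have -> : [set: T] = set0 by apply/seteqP; split=> // w _; have := max_card (pred1 (X w)); rewrite card1 A0.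
  by rewrite measure0 => /eqP; rewrite eqe eq_sym oner_eq0.
have /card_gt0P[a0 _] := A0.
have cE : c = (fine c)%:E.
  by rewrite fineK// -((cX a0).2) fin_num_measure.
have PQ (B : pred A) : P [set w | B (X w)] = (fine c *+ #|B|)%:E.
  rewrite finite_valued_prob// (eq_bigr (fun=> (fine c)%:E)) => [|a _].
    by rewrite sumEFin sumr_const.
  by rewrite -cE; have [] := cX a.
rewrite PQ; congr EFin; have := probability_setT P.
rewrite (_ : setT = [set w | predT (X w)]) ?PQ; last by apply/seteqP.
move=> [] /esym; rewrite -[(fine c *+ _)%R]mulr_natr => c1.
have A1 : (#|A|%:R : R) != 0%R by rewrite pnatr_eq0 -lt0n.
by apply: (mulIf A1); rewrite divfK// -[(fine c *+ _)%R]mulr_natr mulrAC -c1 mul1r.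
Qed.

(** The fibres of a surjective group morphism are translates of its kernel, hence have the same
    size. *)
Lemma equidistributed_morphism (I : finType) (V B : finZmodType)
    (X : T -> {ffun I -> V}) (phi : {ffun I -> V} -> B) :
  {morph phi : x y / (x - y)%R} -> (forall b, exists a, phi a = b) ->
  equidistributed X -> equidistributed (fun w => phi (X w)).
Proof.
move=> phiB surj eX; exists ((#|[pred a | phi a == 0%R]|%:R / #|{: {ffun I -> V}}|%:R)%:E) => b.
have [a0 a0b] := surj b.
have -> : [set w | phi (X w) = b] = [set w | [pred a | phi a == b] (X w)].
  by apply/seteqP; split => w /= /eqP.
have [mb ->] := equidistributed_prob [pred a | phi a == b] eX; split=> //.
congr (_%:R / _)%:E; rewrite -[RHS](fintype.card_image (@addIr _ a0)).
apply: eq_card => a; rewrite [LHS]inE; apply/eqP/fintype.imageP => [ab|[a' + ->]].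
  by exists (a - a0)%R; rewrite ?subrK// inE phiB ab a0b subrr.
rewrite inE => /eqP a'0; rewrite -a0b -[RHS]add0r -a'0 -[in RHS](addrK a0 a').
by rewrite phiB subrK.
Qed.

End Equidistribution.

Section UniformPadic.
Local Open Scope classical_set_scope.
Local Open Scope ereal_scope.
Context (R : realType) (disp : measure_display) (T : measurableType disp)
  (P : probability T R) (p : nat) (p_pr : prime p).
Local Notation Zp := (padic_int p_pr).

Lemma red_fiber_measurable k (r : 'Z_(p ^ k.+1)) : measurable [set x : Zp | red k x = r].
Proof.
apply: sub_sigma_algebra; suff : padic_open [set x : Zp | red k x = r] by [].
move=> x /= xr; exists k.+1 => y yx.
by rewrite /= -xr; apply/red_eq.
Qed.

Lemma red_event (X : T -> Zp) k (r : 'Z_(p ^ k.+1)) :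
  rv_events X [set w | red k (X w) = r].
Proof.
exists [set x : Zp | red k x = r]; first exact: red_fiber_measurable.
by rewrite setTI.
Qed.

(** Translation by a lift of r carries the fibre over 0 onto the fibre over r. *)
Lemma uniform_padic_red (X : T -> Zp) k (r : 'Z_(p ^ k.+1)) : uniform_padic P X ->
  measurable [set w | red k (X w) = r] /\
  P [set w | red k (X w) = r] = P [set w | red k (X w) = 0%R].
Proof.
move=> [mX tX]; split.
  by have := mX measurableT _ (red_fiber_measurable r); rewrite setTI.
have := tX (lift_red p_pr r) [set x : Zp | red k x = 0%R] (red_fiber_measurable 0%R).
rewrite /pushforward => <-; congr (P _); apply/seteqP; split=> w /=.
  move=> wr; exists (X w - lift_red p_pr r)%R; last by rewrite addrC subrK.
  by rewrite rmorphB /= wr lift_redK subrr.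
by move=> [x x0 <-]; rewrite rmorphD /= x0 lift_redK addr0.
Qed.

End UniformPadic.

(** * Joint law of the coefficients modulo p^(K+1) *)

Section HomogeneousSystem.
Local Open Scope classical_set_scope.
Local Open Scope ereal_scope.
Variables (p : nat) (p_pr : prime p) (n : nat) (d : 'I_n -> nat).
Local Notation Zp := (padic_int p_pr).
Local Notation "'R_ k" := ('Z_(p ^ k.+1)) (at level 8, k at level 2).
Local Notation bound := (\max_i d i).+1.

(** Monomials of bounded degree form a finite type; their bound is strict, hence the successor in
    [bound]. *)
Definition mon_index : {pred 'I_n * bmultinom n.+1 bound} :=
  [pred x | mdeg (bmnm x.2) == d x.1].

Local Notation J := {x | x \in mon_index}.

Definition coef_res K (F : 'I_n -> mpoly n.+1 Zp) : {ffun J -> 'R_K} :=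
  [ffun x => red K (mcoeff (bmnm (val x).2) (F (val x).1))].

Definition mons i : seq (multinom n.+1) :=
  [seq bmnm b | b <- enum [pred b : bmultinom n.+1 bound | mdeg (bmnm b) == d i]].

(** Extending g by 0 to all monomials allows events indexed as in the independence hypotheses. *)
Definition coef_at K (g : {ffun J -> 'R_K}) (i : 'I_n) (m : multinom n.+1) : 'R_K :=
  if insub m : option (bmultinom n.+1 bound) is Some b then
    if insub (i, b) : option J is Some x then g x else 0%R
  else 0%R.

Lemma coef_atE K (g : {ffun J -> 'R_K}) (x : J) :
  coef_at g (val x).1 (bmnm (val x).2) = g x.
Proof. by rewrite /coef_at (valK (val x).2) -surjective_pairing valK. Qed.

Lemma mons_index (x : J) : bmnm (val x).2 \in mons (val x).1.
Proof. by apply: map_f; rewrite mem_enum inE; exact: (valP x). Qed.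

Lemma mons_uniq i : uniq (mons i).
Proof. by rewrite map_inj_uniq ?enum_uniq//; exact: val_inj. Qed.

Lemma mem_mons i m : m \in mons i -> exists x : J, i = (val x).1 /\ m = bmnm (val x).2.
Proof.
move=> /mapP[b]; rewrite mem_enum inE => bd ->.
have ib : (i, b) \in mon_index by [].
by exists (exist (fun x => x \in mon_index) (i, b) ib).
Qed.

Context (R : realType) (disp : measure_display) (T : measurableType disp)
  (P : probability T R).
Variable f : forall i : 'I_n, T -> dhomog n.+1 Zp (d i).
Hypothesis f_uniform : forall i, uniform_hpoly P (f i).
Hypothesis f_indep :
  mutually_independent P [set: 'I_n] (fun i => hpoly_events (f i)).

(** The event that the residues equal g factors, by independence of the polynomials and then of the
    coefficients of each. No factor depends on the prescribed residue. *)
Lemma equidistributed_coef_res K :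
  equidistributed P (fun w => coef_res K (fun i => f i w)).
Proof.
pose c i m := P [set w | red K (mcoeff m (f i w)) = 0%R].
exists (\prod_(i <- enum 'I_n) \prod_(m <- mons i) c i m) => g.
pose E i m := [set w | red K (mcoeff m (f i w)) = coef_at g i m].
have E_c i m : m \in mons i -> measurable (E i m) /\ P (E i m) = c i m.
  move=> /mem_mons[x [-> ->]]; apply: uniform_padic_red.
  by apply: (f_uniform _).1; apply/eqP; exact: (valP x).
have -> : [set w | coef_res K (fun i => f i w) = g] =
    \bigcap_(i in [set` enum 'I_n]) \bigcap_(m in [set` mons i]) E i m.
  apply/seteqP; split=> [w /= wg i _ m /mem_mons[x [-> ->]]|w wE].
    by rewrite /E /= coef_atE -wg ffunE.
  apply/ffunP => x; rewrite ffunE -coef_atE.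
  by apply: (wE (val x).1) => /=; [rewrite mem_enum|exact: mons_index].
split.
  apply: fin_bigcap_measurable => [|i _]; first exact: finite_seq.
  by apply: fin_bigcap_measurable => [|m /E_c[]//]; exact: finite_seq.
rewrite f_indep ?enum_uniq//; last first.
  move=> i _; apply: (@fin_bigcap_measurable _ (g_sigma_algebraType
    (\bigcup_(m in [set: multinom n.+1]) rv_events (fun w => mcoeff m (f i w))))).
    exact: finite_seq.
  by move=> m _; apply: sub_sigma_algebra; exists m => //; exact: red_event.
apply: eq_bigr => i _; rewrite (f_uniform i).2 ?mons_uniq//.
- by apply: eq_big_seq => m /E_c[].
- by move=> m /= /mem_mons[x [-> ->]]; apply/eqP; exact: (valP x).
- by move=> m _; exact: red_event.
Qed.

End HomogeneousSystem.

Arguments mon_index {n} d _.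

(** * The reduced jet as a linear image of the reduced coefficients *)

Section JetMap.
Variables (p : nat) (p_pr : prime p) (n : nat) (d : 'I_n -> nat).
Local Notation Zp := (padic_int p_pr).
Local Notation "'R_ k" := ('Z_(p ^ k.+1)) (at level 8, k at level 2).
Local Notation bound := (\max_i d i).+1.
Local Notation J := {x | x \in mon_index d}.

Definition homogeneous (F : 'I_n -> mpoly n.+1 Zp) : Prop :=
  forall i m, mdeg m != d i -> mcoeff m (F i) = 0.

(** A linear functional becomes modulo p^(K+1) a linear form in the reduced coefficients. This is
    applied to evaluations and to jet entries. *)
Lemma red_functional K (tau : mpoly n.+1 Zp -> Zp) F i :
  {morph tau : f g / f + g} -> (forall c f, tau (c *: f) = c * tau f) ->
  homogeneous F ->
  red K (tau (F i)) = \sum_(x : J | (val x).1 == i)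
    coef_res d K F x * red K (tau (mpolyX Zp (bmnm (val x).2))).
Proof.
move=> tauD tauZ hF.
have tau0 : tau 0 = 0 by rewrite -(scale0r (0 : mpoly n.+1 Zp)) tauZ mul0r.
have size_F : (mmeasure mdeg (F i) <= bound)%N.
  rewrite mmeasureE; apply/bigmax_leqP_seq => m + _; rewrite mcoeff_msupp => Fm.
  suff : (mdeg m <= \max_i d i)%N by [].
  have [->|/hF] := eqVneq (mdeg m) (d i); first exact: leq_bigmax.
  by move=> Fm0; rewrite Fm0 eqxx in Fm.
rewrite {1}(mpolywE size_F) (big_morph tau tauD tau0) rmorph_sum /=.
rewrite (bigID (fun b : bmultinom n.+1 bound => mdeg (bmnm b) == d i)) /=.
rewrite [X in _ + X]big1 ?addr0 => [|b /hF ->]; last first.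
  by rewrite tauZ mul0r; exact: rmorph0.
under [RHS]eq_bigr do rewrite ffunE.
pose G (x : 'I_n * bmultinom n.+1 bound) := red K (mcoeff (bmnm x.2) (F x.1)) * red K (tau (mpolyX Zp (bmnm x.2))).
rewrite -(big_sub_cond (mon_index d) [pred x | x.1 == i] G) /=.
rewrite (reindex_onto (fun b => (i, b)) snd) /=; last first.
  by move=> [i' b] /= /andP[_ /eqP ->].
apply: eq_big => [b|b _]; first by rewrite unfold_in /= !eqxx !andbT.
by rewrite /G /= tauZ rmorphM.
Qed.

Section Jet.
Variables (K : nat) (j : 'I_n.+1) (b : 'cV[Zp]_n.+1).

Definition jet_entry s (f : mpoly n.+1 Zp) : Zp :=
  if s == j then cv_eval f b else cv_eval (mderiv s f) b.

Lemma jet_entryD s : {morph jet_entry s : f g / f + g}.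
Proof. by move=> f g; rewrite /jet_entry /cv_eval mderivD; case: ifP; rewrite !mevalD. Qed.

Lemma jet_entryZ s c f : jet_entry s (c *: f) = c * jet_entry s f.
Proof. by rewrite /jet_entry /cv_eval mderivZ; case: ifP; rewrite !mevalZ. Qed.

Definition jet_map (g : {ffun J -> 'R_K}) : 'M['R_K]_(n, n.+1) :=
  \matrix_(i, s) \sum_(x : J | (val x).1 == i)
    g x * red K (jet_entry s (mpolyX Zp (bmnm (val x).2))).

Lemma jet_mapB : {morph jet_map : g h / g - h}.
Proof.
move=> g h; apply/matrixP => i s; rewrite !mxE -sumrB; apply: eq_bigr => x _.
by rewrite !ffunE mulrBl.
Qed.

Lemma jet_map_coef F : homogeneous F ->
  jet_map (coef_res d K F) = map_mx (red K) (jet j F b).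
Proof.
move=> hF; apply/matrixP => i s; rewrite !mxE -(red_functional K i _ _ hF).
- by rewrite /jet_entry; case: ifP.
- exact: jet_entryD.
- exact: jet_entryZ.
Qed.

(* The preimage of A is the reduction of
   (A_ij - sum_s A_is b_s) X_j^d + sum_s A_is X_j^(d-1) X_s, s <> j. *)
Lemma jet_map_surj : (forall i, (0 < d i)%N) -> b j 0 = 1 ->
  forall A, exists g, jet_map g = A.
Proof.
move=> d_gt0 bj A; pose a i s := lift_red p_pr (A i s).
pose mj i := mnm_muln (mnm1 j) (d i).
pose ms i (s : 'I_n.+1) := mnm_add (mnm_muln (mnm1 j) (d i).-1) (mnm1 s).
pose F i : mpoly n.+1 Zp :=
  (a i j - \sum_(s | s != j) a i s * b s 0) *: mpolyX Zp (mj i)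
  + \sum_(s | s != j) a i s *: mpolyX Zp (ms i s).
have hF : homogeneous F.
  move=> i m md; rewrite mcoeffD mcoeffZ mcoeffX [X in _ + X]raddf_sum [X in _ + X]big1 /= => [|s _].
    rewrite addr0; case: eqP => [mE|_]; last exact: mulr0.
    by move: md; rewrite -mE mdegMn mdeg1 mul1n eqxx.
  rewrite mcoeffZ mcoeffX; case: eqP => [mE|_]; last exact: mulr0.
  by move: md; rewrite -mE mdegD mdegMn !mdeg1 mul1n addn1 prednK ?eqxx.
exists (coef_res d K F); rewrite jet_map_coef//.
have evp e : cv_eval (mpolyX Zp (mnm_muln (mnm1 j) e)) b = 1.
  rewrite /cv_eval -mpolyXn rmorphXn /= mevalXU bj; exact: expr1n.
have evs i s : cv_eval (mpolyX Zp (ms i s)) b = b s 0.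
  rewrite mpolyXD /cv_eval mevalM mevalXU -[LHS]/(cv_eval _ b * _) evp.
  exact: mul1r.
have j0 s : jet_entry s 0 = 0.
  by rewrite -(scale0r (0 : mpoly n.+1 Zp)) jet_entryZ mul0r.
have jD s := big_morph (jet_entry s) (jet_entryD s) (j0 s).
apply/matrixP => i s; rewrite !mxE -[if _ then _ else _]/(jet_entry s (F i)).
rewrite -[RHS](lift_redK p_pr); congr (red K _).
rewrite jet_entryD jet_entryZ jD.
under eq_bigr do rewrite jet_entryZ.
rewrite /jet_entry; have [->|sj] := eqVneq s j.
  rewrite evp mulr1.
  under eq_bigr do rewrite evs.
  exact: subrK.
have dXj e : mderiv s (mpolyX Zp (mnm_muln (mnm1 j) e)) = 0.
  by rewrite mderivX mulmnE mnm1E eq_sym (negPf sj) mul0n scale0r.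
rewrite dXj [X in X + _](_ : _ = 0) ?add0r; last first.
  by rewrite /cv_eval meval0; exact: mulr0.
rewrite (bigD1 s)//= [X in _ + X]big1 ?addr0 => [|u /andP[uj us]].
  rewrite mderivX mnmDE mulmnE !mnm1E eqxx eq_sym (negPf sj) mul0n add0n addmK.
  by rewrite scale1r evp mulr1.
rewrite mderivX mnmDE mulmnE !mnm1E eq_sym (negPf sj) mul0n add0n (negPf us).
by rewrite scale0r /cv_eval meval0; exact: mulr0.
Qed.

End Jet.

End JetMap.

(** * Expected number of zeros *)

Section ExpectedZeros.
Local Open Scope classical_set_scope.
Local Open Scope ereal_scope.
Variables (p : nat) (p_pr : prime p) (n : nat) (d : 'I_n -> nat).
Hypothesis d_gt0 : forall i, (0 < d i)%N.
Local Notation Zp := (padic_int p_pr).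
Local Notation "'R_ k" := ('Z_(p ^ k.+1)) (at level 8, k at level 2).
Local Notation J := {x | x \in mon_index d}.
Local Notation PP := (projective_space {fraction Zp} n).
Local Notation ball k := ('I_n.+1 * 'cV['R_k]_n.+1)%type.
Context (R : realType) (disp : measure_display) (T : measurableType disp)
  (P : probability T R).
Variable f : forall i : 'I_n, T -> dhomog n.+1 Zp (d i).
Hypothesis f_uniform : forall i, uniform_hpoly P (f i).
Hypothesis f_indep :
  mutually_independent P [set: 'I_n] (fun i => hpoly_events (f i)).

Local Notation F w := (fun i => f i w : mpoly n.+1 Zp).

Lemma homogeneous_system w : homogeneous d (F w).
Proof.
by move=> i m md; rewrite (dhomog_nemf_coeff _ md)//; exact: dhomog_is_dhomog.
Qed.

Definition zero_event k (jb : ball k) : set T :=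
  [set w | exists x : 'cV[Zp]_n.+1, [/\ normalized jb.1 x, map_mx (red k) x = jb.2 &
    forall i, cv_eval (F w i) x = 0%R]].

(** By compactness a zero exists iff approximate zeros exist modulo all powers of p, and each of
    these conditions depends only on finitely many residues of coefficients. *)
Lemma zero_event_measurable k (jb : ball k) : measurable (zero_event jb).
Proof.
pose Q m (g : {ffun J -> 'R_m}) : bool := `[< exists x : 'cV[Zp]_n.+1,
  [/\ normalized jb.1 x, map_mx (red k) x = jb.2 & forall i,
    (\sum_(y : J | (val y).1 == i)
      g y * red m (cv_eval (mpolyX Zp (bmnm (val y).2)) x))%R = 0%R] >].
have QE m w x i : (\sum_(y : J | (val y).1 == i) coef_res d m (F w) y *
      red m (cv_eval (mpolyX Zp (bmnm (val y).2)) x))%R = red m (cv_eval (F w i) x).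
  rewrite -(red_functional (tau := fun h => cv_eval h x) m i _ _ (homogeneous_system w))//.
    by move=> g h; exact: mevalD.
  by move=> c h; exact: mevalZ.
have -> : zero_event jb = \bigcap_m [set w | Q m (coef_res d m (F w))].
  apply/seteqP; split=> [w [x [nx xb Fx]] m _ /=|w wQ].
    by apply/asboolP; exists x; split=> // i; rewrite QE Fx rmorph0.
  apply: zero_in_ball_compact => m; have /asboolP[x [nx xb Qx]] := wQ m I.
  exists x; split=> // i; have := Qx i; rewrite QE => /red_eq0.
  exact: residue_weaken0 (leqnSn m).
apply: bigcapT_measurable => m.
exact: (equidistributed_prob _ (equidistributed_coef_res f_uniform f_indep m)).1.
Qed.

Section Level.
Variable k : nat.
Local Notation K := (k + k.+1)%N.
Local Notation M := 'M['R_K]_(n, n.+1).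
Local Notation frac X := (X%:R / #|{: M}|%:R : R)%R.

(** The error term is charged only to pairs that come from a normalised vector, whose number
    [card_balls] bounds. *)
Definition attained (jb : ball k) : bool :=
  `[< exists x : 'cV[Zp]_n.+1, normalized jb.1 x /\ map_mx (red k) x = jb.2 >].

Definition degenerate (j : 'I_n.+1) (A : M) : bool :=
  col_vanishes p_pr k.+1 j A && det_vanishes p_pr k.+1 j A.

Lemma jet_equidistributed j (b : 'cV[Zp]_n.+1) : (b j 0 = 1)%R ->
  equidistributed P (fun w => map_mx (red K) (jet j (F w) b)).
Proof.
move=> bj.
have -> : (fun w => map_mx (red K) (jet j (F w) b)) =
    (fun w => jet_map j b (coef_res d K (F w))).
  by apply/funext => w; rewrite jet_map_coef//; exact: homogeneous_system.
apply: equidistributed_morphism; first exact: jet_mapB.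
  exact: jet_map_surj.
exact: equidistributed_coef_res.
Qed.

(** Solvability of the linearised system implies a zero, and a zero implies solvability or
    degeneracy. Both are events of an equidistributed jet, so their probabilities are counts of
    matrices. *)
Lemma zero_event_bounds (jb : ball k) :
  ((frac #|[set A : M | kernel_in_ball p_pr jb A]%SET|)%:E <= P (zero_event jb)) /\
  (P (zero_event jb) <= (frac #|[set A : M | kernel_in_ball p_pr jb A]%SET| +
     if attained jb then frac #|[set A : M | degenerate jb.1 A]%SET| else 0)%R%:E).
Proof.
have [at_jb|nat_jb] := boolP (attained jb); last first.
  have -> : zero_event jb = set0.
    apply/seteqP; split=> // w [x [nx xb _]]; move/asboolP: nat_jb; apply.
    by exists x.
  rewrite (_ : finset _ = finset.set0) ?cards0 ?mul0r ?addr0 ?measure0//.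
  apply/setP => A; rewrite !inE; apply/negP => /andP[/asboolP[x [nx xb _]] _].
  by move/asboolP: nat_jb; apply; exists x.
case: jb at_jb => j _ /asboolP[b /= [nb <-]].
rewrite -card_solvable_at//.
have eJ := jet_equidistributed (proj1 nb).
have [mS PS] := equidistributed_prob (solvable_at p_pr j) eJ.
have [mD PD] := equidistributed_prob (degenerate j) eJ.
rewrite !cardsE; split.
  rewrite -PS; apply: le_measure; rewrite ?inE//; first exact: zero_event_measurable.
  by move=> w /= /(solvable_zero_in_ball nb).
rewrite EFinD -PS -PD.
apply: (@le_trans _ _ (P ([set w | solvable_at p_pr j (map_mx (red K) (jet j (F w) b))] `|`
    [set w | degenerate j (map_mx (red K) (jet j (F w) b))]))); last exact: measureU2.
apply: le_measure; rewrite ?inE//; first exact: zero_event_measurable.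
  exact: measurableU.
move=> w [x [nx xb Fx]] /=.
by have /orP[] := zero_in_ball_solvable nb nx xb Fx; [left|right].
Qed.

(** Below, the loss is the proportion of matrices whose minors all vanish modulo P, at most n / N.
    Above, there are at most (n+1) p^((k+1)n) balls, each with an error of at most n / (N
    p^((k+1)n)); the powers of p cancel. *)
Lemma sum_zero_event_bounds N : (0 < N)%N ->
  (forall c j, (c <= K.+1)%N -> (N * p ^ (c * n) *
    #|[set A : M | col_vanishes p_pr c j A && det_vanishes p_pr k.+1 j A]%SET|
    <= n * #|{: M}|)%N) ->
  (1 - n%:R / N%:R <= \sum_jb fine (P (zero_event (k := k) jb)) <=
   1 + (n.+1 * n)%:R / N%:R)%R.
Proof.
move=> N0 vanN.
have m0 : ((0 : R) < #|{: M}|%:R)%R by rewrite ltr0n; apply/card_gt0P; exists 0%R.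
have N0' : ((0 : R) < N%:R)%R by rewrite ltr0n.
have Pfin jb : (P (zero_event (k := k) jb)) = (fine (P (zero_event jb)))%:E.
  by rewrite fineK// fin_num_measure//; exact: zero_event_measurable.
pose g := #|[set A : M | [exists j, ~~ det_vanishes p_pr k.+1 j A]]%SET|.
have sum_ker : (\sum_(jb : ball k) frac #|[set A : M | kernel_in_ball p_pr jb A]%SET|
    = frac g :> R)%R.
  by rewrite -mulr_suml -natr_sum sum_card_kernel_in_ball.
apply/andP; split.
  apply: (@le_trans _ _ (frac g)); last first.
    rewrite -sum_ker; apply: ler_sum => jb _.
    by have [+ _] := zero_event_bounds jb; rewrite Pfin lee_fin.
  rewrite ler_pdivlMr// mulrBl mul1r lerBlDr mulrAC.
  pose b := #|[set A : M | det_vanishes p_pr k.+1 ord0 A]%SET|.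
  have mgb : (#|{: M}| <= g + b)%N.
    rewrite -cardsUI -cardsT; apply: leq_trans (leq_addr _ _).
    apply/subset_leq_card/fintype.subsetP => A _; rewrite !inE orbC.
    by case: (boolP (det_vanishes _ _ _ _)) => //= dA; apply/existsP; exists ord0.
  apply: (@le_trans _ _ (g%:R + b%:R)%R); first by rewrite -natrD ler_nat.
  rewrite lerD2l ler_pdivlMr// -!natrM ler_nat mulnC.
  (* With c = 0 the condition on the column holds for every matrix. *)
  have := vanN 0%N ord0 (leq0n _); rewrite mul0n expn0 muln1.
  rewrite (_ : [set A : M | _]%SET = [set A : M | det_vanishes p_pr k.+1 ord0 A]%SET)//.
  apply/setP => A; rewrite !inE (_ : col_vanishes _ _ _ _)//.
  by apply/forallP => i; rewrite residue_at0.
apply: (@le_trans _ _ (\sum_(jb : ball k) (frac #|[set A : M | kernel_in_ball p_pr jb A]%SET|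
   + if attained jb then frac #|[set A : M | degenerate jb.1 A]%SET| else 0))%R).
  apply: ler_sum => jb _.
  by have [_] := zero_event_bounds jb; rewrite Pfin lee_fin.
rewrite big_split /= sum_ker; apply: lerD.
  by rewrite ler_pdivrMr// mul1r ler_nat max_card.
rewrite -big_mkcond /=.
apply: (@le_trans _ _ (\sum_(jb : ball k | attained jb) (n%:R / (N * p ^ (k.+1 * n))%:R))%R).
  apply: ler_sum => jb _.
  rewrite ler_pdivrMr// mulrAC ler_pdivlMr ?ltr0n ?muln_gt0 ?N0 ?expn_gt0 ?prime_gt0//.
  by rewrite -!natrM ler_nat mulnC vanN// leqW// leq_addl.
rewrite sumr_const -[(_ *+ _)%R]mulr_natr.
have p0 : (0 < p ^ (k.+1 * n))%N by rewrite expn_gt0 prime_gt0.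
rewrite mulrAC ler_pdivrMr ?ltr0n ?muln_gt0 ?N0// mulrAC ler_pdivlMr//.
rewrite -!natrM ler_nat.
have -> : (n.+1 * n * (N * p ^ (k.+1 * n)) = n * (n.+1 * p ^ (k.+1 * n)) * N)%N.
  by rewrite [(n.+1 * n)%N]mulnC -!mulnA [(N * _)%N]mulnC.
rewrite leq_mul2r leq_mul2l; apply/orP; right; apply/orP; right.
by have := card_balls p_pr n k; rewrite cardsE.
Qed.

End Level.

Lemma sum_zero_event_cvg :
  \sum_jb P (zero_event (k := k) jb) @[k --> \oo] --> (1 : \bar R).
Proof.
have PE k : \sum_jb P (zero_event (k := k) jb) =
    (\sum_jb fine (P (zero_event (k := k) jb)))%R%:E.
  rewrite -sumEFin; apply: eq_bigr => jb _.
  by rewrite fineK// fin_num_measure//; exact: zero_event_measurable.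
under eq_fun do rewrite PE.
apply: cvg_EFin; first by near=> k.
apply/cvgrPdist_le => e e0.
(* N is fixed before k, large enough for both error terms to be at most e; then k is taken beyond
   the threshold m0 that depends on N. *)
pose N := (Num.bound (e^-1 * (n.+1 * n + n)%:R)).+1.
have Ne : ((n.+1 * n + n)%:R / N%:R <= e)%R.
  rewrite ler_pdivrMr ?ltr0n// mulrC -ler_pdivrMr// mulrC.
  apply/ltW/(lt_trans (archi_boundP _)); last by rewrite ltr_nat.
  by rewrite mulr_ge0// invr_ge0 ltW.
have [m0 m0P] := card_vanishes p_pr n N.
near=> k.
have k0 : (m0 <= k.+1)%N by rewrite leqW//; near: k; exact: nbhs_infty_ge.
have /andP[Sl Su] := @sum_zero_event_bounds k N isT
  (fun c j => m0P (k + k.+1)%N c k.+1 j k0 (leqW (leq_addl k k.+1))).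
have N0 : ((0 : R) <= N%:R^-1)%R by rewrite invr_ge0.
have le_e c : (c <= n.+1 * n + n)%N -> (c%:R / N%:R <= e)%R.
  by move=> cn; apply: le_trans Ne; rewrite ler_wpM2r// ler_nat.
rewrite ler_distl; apply/andP; split.
  by rewrite lerBlDr (le_trans Su)// lerD2l le_e// leq_addr.
by rewrite -lerBlDr (le_trans _ Sl)// lerD2l lerN2 le_e// leq_addl.
Unshelve. all: by end_near.
Qed.

Definition proj_rep (L : PP) : 'I_n.+1 * 'cV[Zp]_n.+1 :=
  projT1 (cid (projective_normalized L)).

Lemma proj_repP (L : PP) : normalized (proj_rep L).1 (proj_rep L).2 /\
  sval L = <[frac_row (proj_rep L).2]>%VS.
Proof. exact: projT2 (cid (projective_normalized L)). Qed.

Definition ball_of k (L : PP) : ball k :=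
  ((proj_rep L).1, map_mx (red k) (proj_rep L).2).

Local Notation zeros w := (proj_zeros (fun i => f i w : mpoly n.+1 Zp)).

(** The balls containing a zero are the cells met by the zero set, since the line spanned by a
    normalised x has x as its chosen representative. *)
Lemma zero_eventP k (jb : ball k) w :
  zero_event jb w <-> exists2 L, zeros w L & ball_of k L = jb.
Proof.
split=> [[x [nx xb Fx]]|[L Lw <-]].
  have [L Lx] := projective_of_normalized nx.
  exists L; first by apply/(proj_zerosP (fun i => f i w) nx Lx).
  have [nL LL] := proj_repP L.
  rewrite Lx in LL; have [jj xx] := frac_row_line_inj nx nL LL.
  by rewrite /ball_of -jj -xx xb -surjective_pairing.
have [nL LL] := proj_repP L; exists (proj_rep L).2; split=> //.
exact/(proj_zerosP (fun i => f i w) nL LL).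
Qed.

Lemma approx_count_zero_event k w :
  ((approx_count ball_of (zeros w) k)%:R%:E : \bar R) =
  \sum_jb (\1_(zero_event (k := k) jb) w)%:E.
Proof.
rewrite sumEFin /approx_count -sum1_card natr_sum big_mkcond /=; congr EFin.
apply: eq_bigr => jb _; rewrite indicE.
have -> : (jb \in [pred v | `[< exists2 L, zeros w L & ball_of k L = v >]]) =
    (w \in zero_event jb).
  by apply/asboolP/idP => [/zero_eventP/mem_set|/set_mem/zero_eventP].
by case: ifP.
Qed.

Lemma ball_of_coarser k L L' : ball_of k.+1 L = ball_of k.+1 L' ->
  ball_of k L = ball_of k L'.
Proof.
move=> [jj LL]; rewrite /ball_of jj; congr pair; apply/matrixP => s u.
move/matrixP/(_ s u) : LL; rewrite !mxE => /red_eq LL.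
by apply/red_eq; exact: residue_weaken LL.
Qed.

(** The cells separate lines because a representative is determined by its residues at all
    levels. *)
Lemma counting_zeros_cvg w :
  \sum_jb (\1_(zero_event (k := k) jb) w)%:E @[k --> \oo] -->
  (counting (zeros w) : \bar R).
Proof.
under eq_fun do rewrite -approx_count_zero_event.
apply: counting_approx.
  exact: ball_of_coarser.
move=> L L' LL; apply/not_existsP => eq_balls; apply: LL.
suff : sval L = sval L' by exact: val_inj.
have [_ ->] := proj_repP L; have [_ ->] := proj_repP L'.
congr (<[frac_row _]>%VS); apply/matrixP => s u; apply: padicP => -[|k].
  by rewrite !residue_at0.
apply/red_eq; have /contrapT[_ /matrixP/(_ s u)] := eq_balls k.
by rewrite !mxE.
Qed.

(** The number of balls containing a zero is nondecreasing in k, so monotone convergence identifies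
    the expectation with the limit of [sum_zero_event_cvg]. *)
Lemma expected_zeros :
  measurable_fun [set: T] (fun w => counting (zeros w) : \bar R) /\
  \int[P]_w (counting (zeros w) : \bar R) = 1.
Proof.
pose N k w := \sum_jb (\1_(zero_event (k := k) jb) w)%:E : \bar R.
have mE k jb : measurable_fun [set: T] (fun w => (\1_(zero_event (k := k) jb) w)%:E : \bar R).
  by apply/measurable_EFinP; apply: measurable_indic; exact: zero_event_measurable.
have mN k : measurable_fun [set: T] (N k) by exact: emeasurable_sum.
split.
  by apply: (@emeasurable_fun_cvg _ _ R setT N _ mN) => w _; exact: counting_zeros_cvg.
have intN k : \int[P]_w N k w = \sum_jb P (zero_event (k := k) jb).
  rewrite ge0_integral_sum//.
  apply: eq_bigr => jb _.
  by rewrite integral_indic ?setIT//; exact: zero_event_measurable.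
have := @cvg_monotone_convergence _ _ R P setT measurableT N mN.
have N0 k w : [set: T] w -> 0 <= N k w.
  by move=> _; apply: sume_ge0 => jb _; rewrite lee_fin.
have Nle w : [set: T] w -> {homo N^~ w : k l / (k <= l)%N >-> k <= l}.
  move=> _ k l kl; rewrite /N -!approx_count_zero_event lee_fin ler_nat.
  exact: (approx_count_nondecreasing ball_of_coarser).
move=> /(_ N0 Nle); under eq_fun do rewrite intN.
move=> /cvg_lim-/(_ _); rewrite (cvg_lim _ sum_zero_event_cvg)// => -> //.
apply: eq_integral => w _; apply/esym/cvg_lim => //; exact: counting_zeros_cvg.
Qed.

End ExpectedZeros.

Unset Implicit Arguments.

Local Open Scope classical_set_scope.
Local Open Scope ereal_scope.

Theorem theorem2 (R : realType) (p : nat) (p_pr : prime p)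
    (n : nat) (n_gt0 : (0 < n)%N)
    (d : 'I_n -> nat) (d_gt0 : forall i, (0 < d i)%N)
    (disp : measure_display) (T : measurableType disp) (P : probability T R)
    (f : forall i : 'I_n, T -> dhomog n.+1 (padic_int p_pr) (d i))
    (f_uniform : forall i, uniform_hpoly P (f i))
    (f_indep : mutually_independent P [set: 'I_n]
                 (fun i => hpoly_events (f i))) :
  let numZ (w : T) : \bar R := counting (proj_zeros (fun i => f i w)) in
  measurable_fun [set: T] numZ /\ \int[P]_w numZ w = 1.
Proof. by move=> numZ; exact: (expected_zeros d_gt0 f_uniform f_indep). Qed.
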